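(* For every $\alpha\in\mathbb{R}$, $t>0$ and $x\in\mathbb{R}$, $$\mathcal{H}_\alpha(x,t)=\mathscr{A}_{W_t}\{y^\alpha\}(x)=\left\langle \mathcal{L}^{-1}\{y^\alpha\}(u),\,e^{-ux-\frac{u^2}{2}t}\right\rangle .$$
   Context: $U(a,z)$ is the standard (Whittaker) parabolic cylinder function, $D_\nu(z)=U(-\nu-\tfrac12,z)$, and $\mathcal{H}_\alpha(x,t)=t^{\frac{\alpha}{2}}e^{\frac{x^2}{4t}}U(-\alpha-\tfrac12,\tfrac{x}{\sqrt t})$. $W$ is a Wiener process, so $\mathbf{E}e^{-uW_t}=e^{\frac{u^2}{2}t}$, and the Appell integral transform with respect to $W$ is $\mathscr{A}_{W_t}\{G\}(x)=\langle \mathcal{L}^{-1}G(u),e^{-ux-\frac{u^2}{2}t}\rangle$, where $\mathcal{L}^{-1}G$ is the generalised function supported on $[0,\infty)$ whose (distributional) Laplace transform $\langle \mathcal{L}^{-1}G(u),e^{-su}\rangle$ equals $G(s)$. Concretely, for $G(y)=y^\alpha$: if $\alpha<0$, $\mathcal{L}^{-1}\{y^\alpha\}(u)=\frac{u^{-\alpha-1}}{\Gamma(-\alpha)}$ for $u>0$ and $0$ for $u<0$; if $\alpha=n\in\mathbb{N}\cup\{0\}$, $\mathcal{L}^{-1}\{y^n\}=\delta^{(n)}$; if $\alpha>0$ is not an integer, $\mathcal{L}^{-1}\{y^\alpha\}={}^C\mathcal{D}^\alpha_{0+}\delta$, the Caputo fractional derivative of order $\alpha$ of the Dirac delta. *)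

(* Defs.v *)
From Stdlib Require Import Reals.
From Coquelicot Require Import Coquelicot.
Open Scope R_scope.

Fixpoint poch (x : R) (k : nat) : R :=
  match k with
  | O => 1
  | S k' => poch x k' * (x + INR k')
  end.

Definition Gamma (x : R) : R :=
  RInt_gen (fun u => Rpower u (x - 1) * exp (- u))
    (at_right 0) (Rbar_locally p_infty).

(* Reciprocal Gamma 1/Gamma(x), entire; 0 at non-positive integers.
   Uses 1/Gamma(x) = (x)_k / Gamma(x+k) for any k with x + k > 0. *)
Definition rgamma (x : R) : R :=
  let k := Z.to_nat (up (- x)) in
  poch x k / Gamma (x + INR k).

Definition kummerM (a b z : R) : R :=
  Series (fun s => poch a s / poch b s * z ^ s / INR (Factorial.fact s)).

(* Whittaker's parabolic cylinder function U(a,z), DLMF 12.2.6-7, 12.4.1,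
   12.7.12-13. *)
Definition pcU0 (a : R) : R :=
  sqrt PI * rgamma (3/4 + a/2) / Rpower 2 (a/2 + 1/4).
Definition pcU0' (a : R) : R :=
  - (sqrt PI * rgamma (1/4 + a/2) / Rpower 2 (a/2 - 1/4)).
Definition pc_u1 (a z : R) : R :=
  exp (- z ^ 2 / 4) * kummerM (a/2 + 1/4) (1/2) (z ^ 2 / 2).
Definition pc_u2 (a z : R) : R :=
  z * exp (- z ^ 2 / 4) * kummerM (a/2 + 3/4) (3/2) (z ^ 2 / 2).
Definition pcU (a z : R) : R := pcU0 a * pc_u1 a z + pcU0' a * pc_u2 a z.

Definition calH (alpha x t : R) : R :=
  Rpower t (alpha / 2) * exp (x ^ 2 / (4 * t)) * pcU (- alpha - 1/2) (x / sqrt t).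

(* Pairing <L^{-1}{y^alpha}(u), phi(u)> of the generalised function
   L^{-1}{y^alpha} (supported on [0,oo)) with phi:
   - alpha < 0 : int_0^oo u^(-alpha-1)/Gamma(-alpha) phi(u) du
   - alpha = n in N : <delta^(n), phi> = (-1)^n phi^(n)(0)
   - alpha > 0 non-integer, n = ceil alpha :
       <C D^alpha_{0+} delta, phi> = <D^n I^(n-alpha) delta, phi>
         = (-1)^n / Gamma(n-alpha) int_0^oo u^(n-alpha-1) phi^(n)(u) du. *)
Definition Linv_pow_pair (alpha : R) (phi : R -> R) : R :=
  if Rlt_dec alpha 0 then
    RInt_gen (fun u => Rpower u (- alpha - 1) / Gamma (- alpha) * phi u)
      (at_right 0) (Rbar_locally p_infty)
  else if Req_EM_T alpha (IZR (Int_part alpha)) then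
    let n := Z.to_nat (Int_part alpha) in
    (-1) ^ n * Derive_n phi n 0
  else
    let n := Z.to_nat (up alpha) in
    (-1) ^ n / Gamma (INR n - alpha) *
    RInt_gen (fun u => Rpower u (INR n - alpha - 1) * Derive_n phi n u)
      (at_right 0) (Rbar_locally p_infty).

Definition appellW_pow (alpha t x : R) : R :=
  Linv_pow_pair alpha (fun u => exp (- u * x - u ^ 2 / 2 * t)).

(* Main.v *)
Require Import Defs.
From Stdlib Require Import ZArith Reals Lra Lia Factorial.
From Coquelicot Require Import Coquelicot.
Open Scope R_scope.

(** For [alpha = -s < 0], expand [exp (- u x)] in [int_0^oo u^(s-1) exp (- u x - t u^2 / 2) du]
    and integrate term by term. The Gaussian moments are values of Gamma, and the even and the
    odd terms sum to the two Kummer series in [U]; Legendre's duplication formula matches the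
    constants. Duplication holds because [2^s Gamma (s/2) Gamma ((s+1)/2) / Gamma s] is
    1-periodic and, by Wendel's inequalities for Gamma, asymptotically independent of [s];
    the same inequalities and the Wallis integrals give [Gamma (1/2) = sqrt PI].

    Both sides then satisfy [H (alpha+1) = x H alpha - alpha t H (alpha-1)]: [calH] by Kummer's
    contiguous relations and [rgamma y = y rgamma (y+1)], the pairing by the recurrence between
    successive derivatives of [exp (- u x - t u^2 / 2)] and an integration by parts. Induction
    on the number of derivatives reduces [alpha >= 0] to [alpha < 0] and to [alpha = 0]. *)

(** * Improper integrals on the positive half-line *)

(** A two-step recurrence needs two neighbouring starting values. For fixed [b > 0] the climb in
    steps of 1 starts at [alpha = - b], and the lower neighbour [- b - 1] is still in the range
    where the pairing is a plain integral. On the integers it starts at [alpha = 0], where the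
    coefficient [alpha t] removes the lower neighbour. On the pairing side that coefficient has two
    sources: differentiating [x + t u] in the kernel gives [n t], and integrating by parts against
    [u^(b-1)] gives [- b t]. With [alpha = n - b] they add up to [alpha t]. The recurrence for
    [calH] must also hold where a Gamma factor has a pole. It is therefore proved with [rgamma] as a
    multiplicative factor and never divides by it. Both Gamma constants come from one squeeze: a
    quantity invariant under a shift is moved far out, where its values agree up to a factor
    [((N + 1) / N) ^ 3]. *)

Local Notation is_int_0oo f l :=
  (is_RInt_gen f (at_right 0) (Rbar_locally p_infty) l).

(** Continuity is asked only on the open half-line because [u^(s-1)] is singular at 0 for
    [s < 1]. *)
Lemma ex_RInt_pos (f : R -> R) a b :
  (forall u, 0 < u -> continuous f u) -> 0 < a -> 0 < b -> ex_RInt f a b.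
Proof.
  intros Hf Ha Hb. apply (@ex_RInt_continuous R_CompleteNormedModule).
  intros z [Hz _]. apply Hf. apply Rlt_le_trans with (2 := Hz).
  now apply Rmin_glb_lt.
Qed.

Lemma filter_prod_0oo (P : R * R -> Prop) a0 b0 :
  0 < a0 -> (forall a b, 0 < a <= a0 -> b0 <= b -> P (a, b)) ->
  filter_prod (at_right 0) (Rbar_locally p_infty) P.
Proof.
  intros Ha0 H.
  apply (Filter_prod _ _ _ (fun a => 0 < a <= a0) (fun b => b0 <= b)).
  - exists (mkposreal a0 Ha0). intros y Hy Hy0. split; trivial.
    unfold ball in Hy; simpl in Hy; unfold AbsRing_ball, minus, plus, opp, abs in Hy; simpl in Hy.
    apply Rabs_def2 in Hy. lra.
  - exists b0. intros y Hy. lra.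
  - intros a b Ha Hb. now apply H.
Qed.

Lemma is_int_0oo_intro (f : R -> R) l :
  (forall u, 0 < u -> continuous f u) ->
  (forall eps, 0 < eps -> exists a0 b0, 0 < a0 /\ 0 < b0 /\
     forall a b, 0 < a <= a0 -> b0 <= b -> Rabs (RInt f a b - l) < eps) ->
  is_int_0oo f l.
Proof.
  intros Hf H P [eps HP].
  destruct (H eps (cond_pos eps)) as (a0 & b0 & Ha0 & Hb0 & Hab).
  apply (filter_prod_0oo _ a0 b0 Ha0).
  intros a b Ha Hb. exists (RInt f a b). split.
  - apply (@RInt_correct R_CompleteNormedModule). apply ex_RInt_pos; simpl; trivial; lra.
  - apply HP. now apply Hab.
Qed.

Lemma is_int_0oo_elim (f : R -> R) l : is_int_0oo f l ->
  forall eps, 0 < eps -> exists a0 b0, 0 < a0 /\ 0 < b0 /\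
     forall a b, 0 < a <= a0 -> b0 <= b -> Rabs (RInt f a b - l) < eps.
Proof.
  intros Hl eps Heps.
  destruct (Hl (fun y => Rabs (y - l) < eps)) as [Q S [d Hd] [M HM] HQS].
  - exists (mkposreal eps Heps). intros y Hy. exact Hy.
  - exists (d / 2), (Rmax 1 (M + 1)). pose proof (cond_pos d).
    split; [lra|]. split; [apply Rlt_le_trans with 1; [lra|apply Rmax_l]|].
    intros a b Ha Hb.
    destruct (HQS a b) as (y & Hy & Hy').
    + apply Hd; [|lra]. unfold ball; simpl; unfold AbsRing_ball, minus, plus, opp, abs; simpl.
      apply Rabs_def1; lra.
    + apply HM. pose proof (Rmax_r 1 (M + 1)). lra.
    + simpl in Hy. now rewrite (is_RInt_unique f a b y Hy).
Qed.

Lemma is_int_0oo_ext (f g : R -> R) l :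
  (forall u, 0 < u -> f u = g u) -> is_int_0oo f l -> is_int_0oo g l.
Proof.
  intros H. apply is_RInt_gen_ext.
  apply (filter_prod_0oo _ 1 1 Rlt_0_1). intros a b Ha Hb; simpl.
  intros u [Hu _]. apply H. apply Rlt_trans with (2 := Hu). apply Rmin_glb_lt; lra.
Qed.

Lemma is_int_0oo_plus (f g : R -> R) lf lg :
  is_int_0oo f lf -> is_int_0oo g lg -> is_int_0oo (fun u => f u + g u) (lf + lg).
Proof. exact (is_RInt_gen_plus f g lf lg). Qed.

Lemma is_int_0oo_scal (f : R -> R) k l :
  is_int_0oo f l -> is_int_0oo (fun u => k * f u) (k * l).
Proof. exact (is_RInt_gen_scal f k l). Qed.

Lemma is_int_0oo_minus (f g : R -> R) lf lg :
  is_int_0oo f lf -> is_int_0oo g lg -> is_int_0oo (fun u => f u - g u) (lf - lg).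
Proof. exact (is_RInt_gen_minus f g lf lg). Qed.

Lemma is_int_0oo_unique (f : R -> R) l1 l2 :
  is_int_0oo f l1 -> is_int_0oo f l2 -> l1 = l2.
Proof.
  intros H1 H2. rewrite <- (is_RInt_gen_unique f l1 H1). exact (is_RInt_gen_unique f l2 H2).
Qed.

(** A nonnegative [f] is its own majorant, so the norm inequality for improper integrals reads
    [|l| <= l]. *)
Lemma is_int_0oo_ge_0 (f : R -> R) l :
  (forall u, 0 < u -> 0 <= f u) -> is_int_0oo f l -> 0 <= l.
Proof.
  intros Hf Hl.
  apply Rle_trans with (1 := norm_ge_0 l).
  apply (@RInt_gen_norm R_CompleteNormedModule (at_right 0) (Rbar_locally p_infty) _ _ f f).
  - apply (filter_prod_0oo _ 1 1 Rlt_0_1); simpl; intros; lra.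
  - apply (filter_prod_0oo _ 1 1 Rlt_0_1); simpl; intros a b Ha Hb u Hu.
    unfold norm, abs; simpl. rewrite Rabs_pos_eq. lra. apply Hf; lra.
  - exact Hl.
  - exact Hl.
Qed.

Lemma is_int_0oo_le (f g : R -> R) lf lg :
  (forall u, 0 < u -> f u <= g u) -> is_int_0oo f lf -> is_int_0oo g lg -> lf <= lg.
Proof.
  intros H Hf Hg.
  assert (0 <= lg - lf); [|lra].
  apply (is_int_0oo_ge_0 (fun u => g u - f u)).
  - intros u Hu; specialize (H u Hu); lra.
  - now apply is_int_0oo_minus.
Qed.

Lemma RInt_incl_le (f : R -> R) a b c d :
  (forall u, 0 < u -> continuous f u) -> (forall u, 0 < u -> 0 <= f u) ->
  0 < a <= b -> b <= c <= d -> RInt f b c <= RInt f a d.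
Proof.
  intros Hc Hp Hab Hcd.
  assert (E : forall p q, 0 < p -> 0 < q -> ex_RInt f p q) by (intros; now apply ex_RInt_pos).
  rewrite <- (RInt_Chasles f a b d), <- (RInt_Chasles f b c d) by (apply E; lra).
  unfold plus; simpl.
  assert (0 <= RInt f a b) by (apply RInt_ge_0; [lra|apply E; lra|intros; apply Hp; lra]).
  assert (0 <= RInt f c d) by (apply RInt_ge_0; [lra|apply E; lra|intros; apply Hp; lra]).
  lra.
Qed.

(** The mass of [f] on [[1, 2]] bounds from below the integral over every larger interval; taking
    this mass as the tolerance in the limit forces [l > 0]. *)
Lemma is_int_0oo_gt_0 (f : R -> R) l :
  (forall u, 0 < u -> continuous f u) -> (forall u, 0 < u -> 0 < f u) ->
  is_int_0oo f l -> 0 < l.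
Proof.
  intros Hc Hp Hl.
  assert (Hm : 0 < RInt f 1 2)
    by (apply RInt_gt_0; [lra|intros; apply Hp; lra|intros; apply Hc; lra]).
  destruct (is_int_0oo_elim f l Hl _ Hm) as (a0 & b0 & Ha0 & Hb0 & H).
  assert (Ha : 0 < Rmin a0 1 <= a0) by (split; [apply Rmin_glb_lt; lra|apply Rmin_l]).
  specialize (H (Rmin a0 1) (Rmax b0 2) Ha (Rmax_l _ _)).
  assert (RInt f 1 2 <= RInt f (Rmin a0 1) (Rmax b0 2)).
  { apply RInt_incl_le; trivial.
    - intros u Hu. left. auto.
    - split; [lra|apply Rmin_r].
    - split; [lra|apply Rmax_r]. }
  apply Rabs_def2 in H. lra.
Qed.

(** The integrals over [[a, b]] grow with the interval, so their supremum is the limit. *)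
Lemma ex_int_0oo_bounded (f : R -> R) M :
  (forall u, 0 < u -> continuous f u) -> (forall u, 0 < u -> 0 <= f u) ->
  (forall a b, 0 < a <= b -> RInt f a b <= M) ->
  exists l, is_int_0oo f l.
Proof.
  intros Hc Hp HM.
  destruct (completeness (fun y => exists a b, 0 < a <= b /\ y = RInt f a b)) as [l [Hub Hlub]].
  - exists M. intros y (a & b & Hab & ->). now apply HM.
  - exists (RInt f 1 1), 1, 1. split; [lra|trivial].
  - exists l. apply is_int_0oo_intro; trivial. intros eps Heps.
    destruct (Classical_Prop.classic (exists a b, 0 < a <= b /\ l - eps < RInt f a b))
      as [(a0 & b0 & Hab0 & H0) | Hno].
    + exists a0, b0. repeat split; try lra. intros a b Ha Hb.
      assert (RInt f a0 b0 <= RInt f a b) by (apply RInt_incl_le; trivial; lra).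
      assert (RInt f a b <= l) by (apply Hub; exists a, b; split; [lra|trivial]).
      apply Rabs_def1; lra.
    + exfalso. assert (l <= l - eps); [|lra]. apply Hlub.
      intros y (a & b & Hab & ->). apply Rnot_lt_le. intros Hlt. apply Hno. now exists a, b.
Qed.

(** Write [f = (f + g) - g]: both pieces are nonnegative, with integrals bounded by [2 M] and
    [M]. *)
Lemma ex_int_0oo_dominated (f g : R -> R) M :
  (forall u, 0 < u -> continuous f u) -> (forall u, 0 < u -> continuous g u) ->
  (forall u, 0 < u -> Rabs (f u) <= g u) ->
  (forall a b, 0 < a <= b -> RInt g a b <= M) ->
  exists l, is_int_0oo f l.
Proof.
  intros Hf Hg Hfg HM.
  assert (Hcs : forall u, 0 < u -> continuous (fun u => f u + g u) u)
    by (intros u Hu; apply (@continuous_plus R_UniformSpace R_AbsRing R_NormedModule); auto).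
  assert (Hbd : forall u, 0 < u -> - g u <= f u <= g u)
    by (intros u Hu; specialize (Hfg u Hu); apply Rabs_le_between in Hfg; lra).
  destruct (ex_int_0oo_bounded g M) as [lg Hlg]; trivial.
  { intros u Hu; specialize (Hbd u Hu); lra. }
  destruct (ex_int_0oo_bounded (fun u => f u + g u) (2 * M)) as [l Hl]; trivial.
  { intros u Hu; specialize (Hbd u Hu); lra. }
  { intros a b Hab.
    apply Rle_trans with (RInt (fun u => scal 2 (g u)) a b).
    - apply RInt_le; try lra.
      + apply ex_RInt_pos; trivial; lra.
      + apply (@ex_RInt_scal R_NormedModule). apply ex_RInt_pos; trivial; lra.
      + intros u Hu. unfold scal; simpl; unfold mult; simpl. assert (Hu0 : 0 < u) by lra.
        specialize (Hbd u Hu0); lra.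
    - rewrite (@RInt_scal R_CompleteNormedModule) by (apply ex_RInt_pos; trivial; lra).
      unfold scal; simpl; unfold mult; simpl. specialize (HM a b Hab); lra. }
  exists (l - lg). apply (is_int_0oo_ext (fun u => (f u + g u) - g u)).
  - intros; ring.
  - now apply is_int_0oo_minus.
Qed.

(** * Mellin integrals of exponentially decaying functions *)

Lemma Rpower_gt_0 u p : 0 < Rpower u p.
Proof. apply exp_pos. Qed.

Lemma is_derive_Rpower u s :
  0 < u -> is_derive (fun v => Rpower v s) u (s * Rpower u (s - 1)).
Proof.
  intros Hu. unfold Rpower. auto_derive; trivial.
  replace ((s - 1) * ln u) with (s * ln u + - ln u) by ring.
  rewrite exp_plus, exp_Ropp, exp_ln by trivial. field. lra.
Qed.

Lemma continuous_Rpower u s : 0 < u -> continuous (fun v => Rpower v s) u.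
Proof.
  intros Hu. apply (@ex_derive_continuous R_AbsRing R_NormedModule).
  eexists. now apply is_derive_Rpower.
Qed.

Lemma ln_le_sub_1 y : 0 < y -> ln y <= y - 1.
Proof.
  intros Hy. pose proof (exp_ineq1_le (ln y)) as H. rewrite exp_ln in H; lra.
Qed.

Lemma exp_le_exp a b : a <= b -> exp a <= exp b.
Proof.
  intros H. destruct (Rle_lt_or_eq_dec _ _ H) as [L|L].
  - left. now apply exp_increasing.
  - right. now rewrite L.
Qed.

(** The constant is the maximum of [u^p exp (- c u)], attained at [u = p / c]; it comes out of
    [ln y <= y - 1] at [y = c u / p]. *)
Lemma Rpower_le_exp p c : 0 < p -> 0 < c ->
  exists C, 0 < C /\ forall u, 0 < u -> Rpower u p <= C * exp (c * u).
Proof.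
  intros Hp Hc. exists (exp (p * ln (p / c) - p)). split; [apply exp_pos|].
  intros u Hu. unfold Rpower. rewrite <- exp_plus.
  assert (Hy : 0 < c * u / p).
  { apply Rdiv_lt_0_compat; trivial. now apply Rmult_lt_0_compat. }
  pose proof (ln_le_sub_1 _ Hy) as H.
  assert (Hln : ln u = ln (c * u / p) + ln (p / c)).
  { rewrite <- ln_mult; trivial.
    - f_equal. field. lra.
    - now apply Rdiv_lt_0_compat. }
  apply exp_le_exp.
  rewrite Hln. apply Rmult_le_compat_l with (r := p) in H; [|lra].
  replace (p * (c * u / p - 1)) with (c * u - p) in H by (field; lra). lra.
Qed.

(** A class that contains [exp (- u)] and the Gaussian kernels, is stable under sums and polynomial
    factors, and has convergent Mellin integrals for all [s > 0]. The bound is one-sided because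
    these functions may grow for negative [u]. *)
Definition exp_decay (h : R -> R) : Prop :=
  (forall u, continuous h u) /\
  exists c C, 0 < c /\ forall u, 0 < u -> Rabs (h u) <= C * exp (- (c * u)).

Lemma exp_decay_ext (f g : R -> R) :
  (forall u, f u = g u) -> exp_decay f -> exp_decay g.
Proof.
  intros E [Hc (c & C & H0 & H)]. split.
  - intros u. apply continuous_ext with (2 := Hc u). exact E.
  - exists c, C. split; trivial. intros u Hu. rewrite <- E. auto.
Qed.

Lemma exp_decay_le (h : R -> R) c C :
  0 < c -> (forall u, continuous h u) ->
  (forall u, 0 < u -> Rabs (h u) <= C * exp (- (c * u))) -> exp_decay h.
Proof. intros; split; trivial. now exists c, C. Qed.

Lemma exp_decay_plus (f g : R -> R) :
  exp_decay f -> exp_decay g -> exp_decay (fun u => f u + g u).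
Proof.
  intros [Hcf (c1 & C1 & H01 & H1)] [Hcg (c2 & C2 & H02 & H2)].
  apply (exp_decay_le _ (Rmin c1 c2) (Rabs C1 + Rabs C2)).
  - now apply Rmin_glb_lt.
  - intros u. now apply (@continuous_plus R_UniformSpace R_AbsRing R_NormedModule).
  - intros u Hu. apply Rle_trans with (1 := Rabs_triang _ _).
    rewrite Rmult_plus_distr_r.
    assert (A : forall C c, Rmin c1 c2 <= c ->
      C * exp (- (c * u)) <= Rabs C * exp (- (Rmin c1 c2 * u))).
    { intros C c Hcc. apply Rle_trans with (Rabs C * exp (- (c * u))).
      - apply Rmult_le_compat_r; [left; apply exp_pos|apply Rle_abs].
      - apply Rmult_le_compat_l; [apply Rabs_pos|].
        apply exp_le_exp. nra. }
    apply Rplus_le_compat; eapply Rle_trans.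
    + now apply H1.
    + apply A. apply Rmin_l.
    + now apply H2.
    + apply A. apply Rmin_r.
Qed.

Lemma exp_decay_scal (f : R -> R) k : exp_decay f -> exp_decay (fun u => k * f u).
Proof.
  intros [Hcf (c & C & H0 & H)].
  apply (exp_decay_le _ c (Rabs k * C) H0).
  - intros u. apply (@continuous_scal_r R_UniformSpace R_AbsRing R_NormedModule). auto.
  - intros u Hu. rewrite Rabs_mult, Rmult_assoc.
    apply Rmult_le_compat_l; [apply Rabs_pos|auto].
Qed.

(** Half of the decay rate pays for the factor [u]. *)
Lemma exp_decay_mul_id (f : R -> R) : exp_decay f -> exp_decay (fun u => u * f u).
Proof.
  intros [Hcf (c & C & H0 & H)].
  destruct (Rpower_le_exp 1 (c / 2)) as (K & HK & HKu); [lra|lra|].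
  apply (exp_decay_le _ (c / 2) (K * C)); [lra| |].
  - intros u. apply (@continuous_mult R_UniformSpace R_AbsRing).
    + apply continuous_id.
    + apply Hcf.
  - intros u Hu. rewrite Rabs_mult, (Rabs_pos_eq u) by lra.
    replace (K * C * exp (- (c / 2 * u)))
      with (K * exp (c / 2 * u) * (C * exp (- (c * u)))).
    + apply Rmult_le_compat; try lra. apply Rabs_pos.
      * rewrite <- (Rpower_1 u) at 1 by trivial. now apply HKu.
      * now apply H.
    + transitivity (K * C * (exp (c / 2 * u) * exp (- (c * u)))); [ring|].
      rewrite <- exp_plus. do 2 f_equal. field.
Qed.

Lemma continuous_mellin_kernel s (h : R -> R) u :
  (forall v, continuous h v) -> 0 < u -> continuous (fun v => Rpower v (s - 1) * h v) u.
Proof.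
  intros Hh Hu. apply (@continuous_mult R_UniformSpace R_AbsRing).
  - now apply continuous_Rpower.
  - apply Hh.
Qed.

(* The integrand is dominated by a multiple of the derivative of the bounded
   function [u^s / (1 + u^s)]. *)
Lemma mellin_ex s (h : R -> R) : 0 < s -> exp_decay h ->
  exists l, is_int_0oo (fun u => Rpower u (s - 1) * h u) l.
Proof.
  intros Hs [Hc (c & C & H0 & H)].
  destruct (Rpower_le_exp (2 * s) c) as (K & HK & HKu); [lra|lra|].
  (* With [y = u^s], [(1 + y)^2 <= 2 + 2 y^2 <= (2 + 2 K) exp (c u)], since
     [y^2 = u^(2s) <= K exp (c u)]. The division by [s] offsets the factor [s] in the derivative of
     [u^s]. *)
  set (D := Rabs C * (2 + 2 * K) / s).
  assert (HD : 0 <= D).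
  { unfold D. apply Rmult_le_pos; [|left; now apply Rinv_0_lt_compat].
    apply Rmult_le_pos; [apply Rabs_pos|lra]. }
  set (G := fun u => D * (Rpower u s / (1 + Rpower u s))).
  set (g := fun u => D * (s * Rpower u (s - 1) / (1 + Rpower u s) ^ 2)).
  assert (Hpos : forall u, 0 < Rpower u s) by (intros; apply Rpower_gt_0).
  assert (HG : forall u, 0 < u -> is_derive G u (g u)).
  { intros u Hu. unfold G, g. specialize (Hpos u).
    apply is_derive_scal.
    evar_last.
    - apply is_derive_div.
      + apply is_derive_Rpower; trivial.
      + apply @is_derive_plus; [apply @is_derive_const|apply is_derive_Rpower; trivial].
      + lra.
    - unfold plus, zero; simpl. field. lra. }
  assert (Hgc : forall u, 0 < u -> continuous g u).
  { intros u Hu. unfold g, Rdiv. pose proof (Hpos u).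
    apply (@continuous_scal_r R_UniformSpace R_AbsRing R_NormedModule).
    apply (@continuous_mult R_UniformSpace R_AbsRing).
    - apply (@continuous_scal_r R_UniformSpace R_AbsRing R_NormedModule).
      now apply continuous_Rpower.
    - apply (@ex_derive_continuous R_AbsRing R_NormedModule).
      unfold Rpower. auto_derive. split; [trivial|split; trivial].
      unfold Rpower in H1.
      assert (0 < (1 + exp (s * ln u)) ^ 2) by (apply pow_lt; lra). simpl in *. lra. }
  apply (ex_int_0oo_dominated _ g D); trivial.
  - intros u Hu. now apply continuous_mellin_kernel.
  - intros u Hu. rewrite Rabs_mult, (Rabs_pos_eq (Rpower u _)) by (left; apply Rpower_gt_0).
    unfold g, D.
    replace (Rabs C * (2 + 2 * K) / s * (s * Rpower u (s - 1) / (1 + Rpower u s) ^ 2))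
      with (Rpower u (s - 1) * (Rabs C * ((2 + 2 * K) / (1 + Rpower u s) ^ 2)))
      by (field; specialize (Hpos u); lra).
    apply Rmult_le_compat_l; [left; apply Rpower_gt_0|].
    apply Rle_trans with (1 := H u Hu).
    apply Rle_trans with (Rabs C * exp (- (c * u))).
    + apply Rmult_le_compat_r; [left; apply exp_pos|apply Rle_abs].
    + apply Rmult_le_compat_l; [apply Rabs_pos|].
      specialize (Hpos u).
      assert (0 < (1 + Rpower u s) ^ 2) by (apply pow_lt; lra).
      rewrite exp_Ropp. apply Rmult_le_reg_r with ((1 + Rpower u s) ^ 2); trivial.
      replace ((2 + 2 * K) / (1 + Rpower u s) ^ 2 * (1 + Rpower u s) ^ 2)
        with (2 + 2 * K) by (field; lra).
      apply Rmult_le_reg_l with (exp (c * u)); [apply exp_pos|].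
      rewrite <- Rmult_assoc, Rinv_r, Rmult_1_l by (apply Rgt_not_eq, exp_pos).
      specialize (HKu u Hu).
      replace (Rpower u (2 * s)) with (Rpower u s ^ 2) in HKu.
      2:{ replace (2 * s) with (s + s) by ring. rewrite Rpower_plus. ring. }
      assert (1 <= exp (c * u)).
      { rewrite <- exp_0. left. apply exp_increasing. now apply Rmult_lt_0_compat. }
      assert (0 <= (Rpower u s - 1) ^ 2) by apply pow2_ge_0. nra.
  - intros a b Hab.
    assert (E : RInt g a b = G b - G a).
    { apply is_RInt_unique. apply (@is_RInt_derive R_CompleteNormedModule).
      - intros u [Hu _]. apply HG. apply Rlt_le_trans with (2 := Hu). apply Rmin_glb_lt; lra.
      - intros u [Hu _]. apply Hgc. apply Rlt_le_trans with (2 := Hu). apply Rmin_glb_lt; lra. }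
    rewrite E. unfold G.
    assert (B : forall u, 0 <= Rpower u s / (1 + Rpower u s) <= 1).
    { intros u. specialize (Hpos u). split.
      - apply Rlt_le, Rdiv_lt_0_compat; lra.
      - apply Rmult_le_reg_r with (1 + Rpower u s); [lra|]. field_simplify; lra. }
    pose proof (B a); pose proof (B b). nra.
Qed.

Definition mellin (s : R) (h : R -> R) : R :=
  RInt_gen (fun u => Rpower u (s - 1) * h u) (at_right 0) (Rbar_locally p_infty).

Lemma mellin_correct s (h : R -> R) : 0 < s -> exp_decay h ->
  is_int_0oo (fun u => Rpower u (s - 1) * h u) (mellin s h).
Proof.
  intros Hs Hh. destruct (mellin_ex s h Hs Hh) as [l Hl].
  unfold mellin. now rewrite (is_RInt_gen_unique _ _ Hl).
Qed.

Lemma mellin_unique s (h : R -> R) l :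
  is_int_0oo (fun u => Rpower u (s - 1) * h u) l -> mellin s h = l.
Proof. exact (is_RInt_gen_unique _ l). Qed.

Lemma mellin_ext s (f g : R -> R) : 0 < s -> exp_decay f ->
  (forall u, 0 < u -> f u = g u) -> mellin s f = mellin s g.
Proof.
  intros Hs Hf E. symmetry. apply mellin_unique.
  apply is_int_0oo_ext with (2 := mellin_correct s f Hs Hf).
  intros u Hu. now rewrite E.
Qed.

Lemma mellin_plus s (f g : R -> R) : 0 < s -> exp_decay f -> exp_decay g ->
  mellin s (fun u => f u + g u) = mellin s f + mellin s g.
Proof.
  intros Hs Hf Hg. apply mellin_unique.
  eapply is_int_0oo_ext; [|apply (is_int_0oo_plus _ _ _ _ (mellin_correct s f Hs Hf) (mellin_correct s g Hs Hg))].
  intros; simpl; ring.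
Qed.

Lemma mellin_scal s k (f : R -> R) : 0 < s -> exp_decay f ->
  mellin s (fun u => k * f u) = k * mellin s f.
Proof.
  intros Hs Hf. apply mellin_unique.
  eapply is_int_0oo_ext; [|apply (is_int_0oo_scal _ k _ (mellin_correct s f Hs Hf))].
  intros; simpl; ring.
Qed.

Lemma mellin_mul_id s (f : R -> R) : 0 < s -> exp_decay f ->
  mellin s (fun u => u * f u) = mellin (s + 1) f.
Proof.
  intros Hs Hf. apply mellin_unique.
  eapply is_int_0oo_ext; [|apply (mellin_correct (s + 1) f); trivial; lra].
  intros u Hu; simpl. replace (s + 1 - 1) with ((s - 1) + 1) by ring.
  rewrite Rpower_plus, Rpower_1 by trivial. ring.
Qed.

Lemma mellin_le s (f g : R -> R) : 0 < s -> exp_decay f -> exp_decay g ->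
  (forall u, 0 < u -> f u <= g u) -> mellin s f <= mellin s g.
Proof.
  intros Hs Hf Hg H.
  apply (is_int_0oo_le _ _ _ _) with (2 := mellin_correct s f Hs Hf) (3 := mellin_correct s g Hs Hg).
  intros u Hu. apply Rmult_le_compat_l; [left; apply Rpower_gt_0|auto].
Qed.

(** The derivative of [u^s h(u)] integrates to 0: the boundary term vanishes at 0 because [s > 0],
    and at infinity by the decay of [h]. *)
Lemma mellin_by_parts s (h h' : R -> R) : 0 < s -> exp_decay h -> exp_decay h' ->
  (forall u, is_derive h u (h' u)) -> mellin (s + 1) h' = - s * mellin s h.
Proof.
  intros Hs Hh Hh' Hd.
  assert (Z : is_int_0oo (fun u => s * (Rpower u (s - 1) * h u) + Rpower u (s + 1 - 1) * h' u) 0).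
  { assert (HF : forall u, 0 < u -> is_derive (fun u => Rpower u s * h u) u
        (s * (Rpower u (s - 1) * h u) + Rpower u (s + 1 - 1) * h' u)).
    { intros u Hu. evar_last.
      - apply @is_derive_mult; [now apply is_derive_Rpower|apply Hd|apply Rmult_comm].
      - unfold plus, mult; simpl. replace (s + 1 - 1) with s by ring. ring. }
    assert (Hcont : forall u, 0 < u -> continuous
        (fun u => s * (Rpower u (s - 1) * h u) + Rpower u (s + 1 - 1) * h' u) u).
    { intros u Hu. apply (@continuous_plus R_UniformSpace R_AbsRing R_NormedModule).
      - apply (@continuous_scal_r R_UniformSpace R_AbsRing R_NormedModule).
        apply continuous_mellin_kernel; trivial. apply Hh.
      - apply continuous_mellin_kernel; trivial. apply Hh'. }
    apply is_int_0oo_intro; trivial.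
    intros eps Heps.
    destruct Hh as [Hc (c & C & H0 & H)].
    (* The exponent [s + 1] leaves a spare factor: [b^s exp (- c b) <= K / b], which is small for
       large [b]. *)
    destruct (Rpower_le_exp (s + 1) c) as (K & HK & HKu); [lra|lra|].
    assert (HC : 0 < Rabs C + 1) by (pose proof (Rabs_pos C); lra).
    assert (Hb : forall u, 0 < u -> Rabs (h u) <= (Rabs C + 1) * exp (- (c * u))).
    { intros u Hu. apply Rle_trans with (1 := H u Hu). apply Rmult_le_compat_r.
      - left; apply exp_pos.
      - pose proof (Rle_abs C); lra. }
    set (e := eps / (2 * (Rabs C + 1))).
    assert (He : 0 < e) by (apply Rdiv_lt_0_compat; lra).
    assert (Heq : (Rabs C + 1) * e = eps / 2) by (unfold e; field; lra).
    (* These make [a^s <= e / 2] and [K / b <= e / 2], so each boundary term stays below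
       [eps / 2]. *)
    exists (Rpower (e / 2) (/ s)), (2 * K / e).
    assert (0 < 2 * K / e) by (apply Rdiv_lt_0_compat; lra).
    split; [apply Rpower_gt_0|split; trivial].
    intros a b Ha Hb'.
    assert (Hab : 0 < b) by lra.
    assert (E : RInt (fun u => s * (Rpower u (s - 1) * h u) + Rpower u (s + 1 - 1) * h' u) a b
      = Rpower b s * h b - Rpower a s * h a).
    { apply is_RInt_unique.
      apply (@is_RInt_derive R_CompleteNormedModule (fun u => Rpower u s * h u)).
      - intros u [Hu _]. apply HF. apply Rlt_le_trans with (2 := Hu). apply Rmin_glb_lt; lra.
      - intros u [Hu _]. apply Hcont. apply Rlt_le_trans with (2 := Hu). apply Rmin_glb_lt; lra. }
    rewrite E, Rminus_0_r.
    assert (Ba : Rabs (Rpower a s * h a) < eps / 2).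
    { rewrite Rabs_mult, (Rabs_pos_eq (Rpower a s)) by (left; apply Rpower_gt_0).
      assert (Rpower a s <= e / 2).
      { apply Rle_trans with (Rpower (Rpower (e / 2) (/ s)) s).
        - apply Rle_Rpower_l; lra.
        - rewrite Rpower_mult, Rinv_l, Rpower_1 by lra. lra. }
      assert (Rabs (h a) <= Rabs C + 1).
      { apply Rle_trans with (1 := Hb a (proj1 Ha)).
        rewrite <- (Rmult_1_r (Rabs C + 1)) at 2. apply Rmult_le_compat_l; [lra|].
        rewrite <- exp_0. left. apply exp_increasing. nra. }
      apply Rle_lt_trans with (e / 2 * (Rabs C + 1)).
      - apply Rmult_le_compat; trivial; [left; apply Rpower_gt_0|apply Rabs_pos].
      - nra. }
    assert (Bb : Rabs (Rpower b s * h b) < eps / 2).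
    { rewrite Rabs_mult, (Rabs_pos_eq (Rpower b s)) by (left; apply Rpower_gt_0).
      specialize (HKu b Hab). rewrite Rpower_plus, Rpower_1 in HKu by trivial.
      apply Rle_lt_trans with (Rpower b s * ((Rabs C + 1) * exp (- (c * b)))).
      - apply Rmult_le_compat_l; [left; apply Rpower_gt_0|auto].
      - rewrite <- Heq. replace (Rpower b s * ((Rabs C + 1) * exp (- (c * b))))
          with ((Rabs C + 1) * (Rpower b s * exp (- (c * b)))) by ring.
        apply Rmult_lt_compat_l; trivial.
        assert (Hx : Rpower b s * exp (- (c * b)) * b <= K).
        { replace K with (K * exp (c * b) * exp (- (c * b))).
          - replace (Rpower b s * exp (- (c * b)) * b) with (Rpower b s * b * exp (- (c * b))) by ring.
            apply Rmult_le_compat_r; [left; apply exp_pos|trivial].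
          - rewrite Rmult_assoc, <- exp_plus, Rplus_opp_r, exp_0. ring. }
        assert (K < e * b).
        { apply Rlt_le_trans with (e * (2 * K / e)).
          - replace (e * (2 * K / e)) with (2 * K) by (field; lra). lra.
          - apply Rmult_le_compat_l; lra. }
        apply Rmult_lt_reg_r with b; trivial. lra. }
    apply Rabs_def2 in Ba, Bb. apply Rabs_def1; lra. }
  pose proof (is_int_0oo_plus _ _ _ _ (is_int_0oo_scal _ s _ (mellin_correct s h Hs Hh))
    (mellin_correct (s + 1) h' ltac:(lra) Hh')) as Q.
  pose proof (is_int_0oo_unique _ _ _ Z Q). lra.
Qed.

(** * The Gamma function *)

Lemma exp_decay_exp : exp_decay (fun u => exp (- u)).
Proof.
  apply (exp_decay_le _ 1 1); [lra| |].
  - intros u. apply (@ex_derive_continuous R_AbsRing R_NormedModule). now auto_derive.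
  - intros u _. rewrite Rabs_pos_eq by (left; apply exp_pos). rewrite !Rmult_1_l. lra.
Qed.

Lemma Gamma_correct x : 0 < x ->
  is_int_0oo (fun u => Rpower u (x - 1) * exp (- u)) (Gamma x).
Proof. intros Hx. exact (mellin_correct x _ Hx exp_decay_exp). Qed.

Lemma Gamma_gt_0 x : 0 < x -> 0 < Gamma x.
Proof.
  intros Hx. apply (is_int_0oo_gt_0) with (3 := Gamma_correct x Hx).
  - intros u Hu. apply (continuous_mellin_kernel x (fun u => exp (- u))); trivial.
    apply exp_decay_exp.
  - intros u Hu. apply Rmult_lt_0_compat; apply exp_pos.
Qed.

Lemma Gamma_plus_1 x : 0 < x -> Gamma (x + 1) = x * Gamma x.
Proof.
  intros Hx.
  pose proof (mellin_by_parts x (fun u => exp (- u)) (fun u => -1 * exp (- u)) Hx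
    exp_decay_exp (exp_decay_scal _ _ exp_decay_exp)) as H.
  rewrite mellin_scal in H; [|lra|apply exp_decay_exp].
  change (mellin (x + 1) (fun u => exp (- u))) with (Gamma (x + 1)) in H.
  change (mellin x (fun u => exp (- u))) with (Gamma x) in H.
  assert (-1 * Gamma (x + 1) = - x * Gamma x); [|lra].
  apply H. intros u. auto_derive; trivial.
Qed.

Lemma Gamma_1 : Gamma 1 = 1.
Proof.
  apply (mellin_unique 1 (fun u => exp (- u))).
  apply (is_int_0oo_ext (fun u => exp (- u))).
  { intros u Hu. rewrite Rminus_diag, Rpower_O by trivial. ring. }
  assert (Hc : forall u, continuous (fun u => exp (- u)) u) by apply exp_decay_exp.
  apply is_int_0oo_intro; [auto|].
  intros eps Heps. exists (eps / 2), (2 / eps).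
  assert (0 < 2 / eps) by (apply Rdiv_lt_0_compat; lra).
  split; [lra|split; [lra|]]. intros a b Ha Hb.
  assert (E : RInt (fun u => exp (- u)) a b = - exp (- b) - - exp (- a)).
  { apply is_RInt_unique.
    apply (@is_RInt_derive R_CompleteNormedModule (fun u => - exp (- u))); intros u _.
    - auto_derive; trivial. ring.
    - apply Hc. }
  rewrite E. pose proof (exp_ineq1_le (- a)). pose proof (exp_pos (- b)).
  assert (exp (- a) < 1) by (rewrite <- exp_0; apply exp_increasing; lra).
  assert (exp (- b) < eps / 2).
  { rewrite exp_Ropp. pose proof (exp_ineq1_le b).
    replace (eps / 2) with (/ (2 / eps)) by (field; lra).
    apply Rinv_lt_contravar; [|lra].
    apply Rmult_lt_0_compat; lra. }
  apply Rabs_def1; lra.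
Qed.

(** With [v = y^s], bound [y = v exp ((1 - s) ln y)] and [1 = v exp (- s ln y)] below by
    [exp w >= 1 + w]. Weights [s] and [1 - s] cancel the logarithms and leave [v]. *)
Lemma Rpower_le_tangent y s : 0 < y -> 0 <= s <= 1 -> Rpower y s <= (1 - s) + s * y.
Proof.
  intros Hy Hs. unfold Rpower. set (v := exp (s * ln y)).
  assert (Hv : 0 < v) by apply exp_pos.
  assert (E1 : y = v * exp ((1 - s) * ln y)).
  { unfold v. rewrite <- exp_plus. rewrite <- (exp_ln y) at 1 by trivial. f_equal; ring. }
  assert (E2 : 1 = v * exp (- s * ln y)).
  { unfold v. rewrite <- exp_plus. rewrite <- exp_0. f_equal; ring. }
  pose proof (exp_ineq1_le ((1 - s) * ln y)) as H1.
  pose proof (exp_ineq1_le (- s * ln y)) as H2.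
  apply Rmult_le_compat_l with (r := v) in H1; [|lra].
  apply Rmult_le_compat_l with (r := v) in H2; [|lra].
  rewrite <- E1 in H1. rewrite <- E2 in H2.
  apply Rmult_le_compat_l with (r := s) in H1; [|lra].
  apply Rmult_le_compat_l with (r := 1 - s) in H2; [|lra].
  lra.
Qed.

(* Wendel's inequality: integrate the tangent line bound of [u^s] at [u = a]. *)
Lemma Gamma_plus_le a s : 0 < a -> 0 <= s <= 1 ->
  Gamma (a + s) <= Rpower a s * Gamma a.
Proof.
  intros Ha Hs.
  replace (Rpower a s * Gamma a)
    with (Rpower a s * (1 - s) * Gamma a + Rpower a s * s / a * Gamma (a + 1))
    by (rewrite Gamma_plus_1 by trivial; field; lra).
  refine (is_int_0oo_le _ _ _ _ _ (Gamma_correct (a + s) ltac:(lra))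
    (is_int_0oo_plus _ _ _ _ (is_int_0oo_scal _ (Rpower a s * (1 - s)) _ (Gamma_correct a Ha))
      (is_int_0oo_scal _ (Rpower a s * s / a) _ (Gamma_correct (a + 1) ltac:(lra))))).
  intros u Hu; simpl.
  assert (Hua : 0 < u / a) by now apply Rdiv_lt_0_compat.
  pose proof (Rpower_le_tangent (u / a) s Hua Hs) as H.
  replace (a + s - 1) with ((a - 1) + s) by ring.
  replace (a + 1 - 1) with ((a - 1) + 1) by ring.
  rewrite !Rpower_plus, Rpower_1 by trivial.
  replace (Rpower u s) with (Rpower a s * Rpower (u / a) s).
  2:{ rewrite Rpower_mult_distr by trivial. f_equal. field. lra. }
  pose proof (Rpower_gt_0 u (a - 1)). pose proof (Rpower_gt_0 a s). pose proof (exp_pos (- u)).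
  apply Rle_trans with (Rpower u (a - 1) * exp (- u) * Rpower a s * ((1 - s) + s * (u / a))).
  - replace (Rpower u (a - 1) * (Rpower a s * Rpower (u / a) s) * exp (- u))
      with (Rpower u (a - 1) * exp (- u) * Rpower a s * Rpower (u / a) s) by ring.
    apply Rmult_le_compat_l; trivial. left. repeat apply Rmult_lt_0_compat; trivial.
  - right. field. lra.
Qed.

(** The upper bound at [a + s] with step [1 - s] reads [a Gamma a <= (a + s)^(1-s) Gamma (a + s)].
    Multiply by [a^s <= (a + s)^s] and bound [a + s] by [a + 1], so that the loss does not depend on
    [s]. *)
Lemma Gamma_plus_ge a s : 0 < a -> 0 <= s <= 1 ->
  a / (a + 1) * (Rpower a s * Gamma a) <= Gamma (a + s).
Proof.
  intros Ha Hs.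
  pose proof (Gamma_plus_le (a + s) (1 - s) ltac:(lra) ltac:(lra)) as H.
  replace (a + s + (1 - s)) with (a + 1) in H by ring.
  rewrite Gamma_plus_1 in H by trivial.
  assert (E : Rpower (a + s) (1 - s) * Rpower (a + s) s = a + s).
  { rewrite <- Rpower_plus. replace (1 - s + s) with 1 by ring. apply Rpower_1; lra. }
  assert (L : Rpower a s <= Rpower (a + s) s) by (apply Rle_Rpower_l; lra).
  pose proof (Rpower_gt_0 (a + s) (1 - s)). pose proof (Rpower_gt_0 a s).
  pose proof (Gamma_gt_0 (a + s) ltac:(lra)).
  apply Rmult_le_reg_l with (a + 1); [lra|].
  replace ((a + 1) * (a / (a + 1) * (Rpower a s * Gamma a)))
    with (Rpower a s * (a * Gamma a)) by (field; lra).
  apply Rle_trans with (Rpower a s * (Rpower (a + s) (1 - s) * Gamma (a + s))).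
  - apply Rmult_le_compat_l; lra.
  - apply Rle_trans with ((a + s) * Gamma (a + s)).
    + rewrite <- Rmult_assoc. apply Rmult_le_compat_r; [lra|].
      apply Rle_trans with (Rpower (a + s) (1 - s) * Rpower (a + s) s); [|lra].
      rewrite Rmult_comm. apply Rmult_le_compat_l; lra.
    + apply Rmult_le_compat_r; lra.
Qed.

(** The factor tends to 1 along arbitrarily large [N]. A cube covers the losses of both
    applications, the Wallis integrals and the duplication formula. *)
Lemma le_of_le_mul_cubes x y : 0 < y ->
  (forall n : nat, exists N, INR n < N /\ x <= ((N + 1) / N) ^ 3 * y) -> x <= y.
Proof.
  intros Hy H. apply Rnot_lt_le. intros Hlt.
  (* For [z = 1 / N <= 1], [(1 + z)^3 <= 1 + 7 z]; beyond this threshold [7 z y] is less than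
     [x - y]. *)
  destruct (nfloor_ex (Rmax 1 (7 * y / (x - y)))) as [n [_ Hn]].
  { apply Rle_trans with 1; [lra|apply Rmax_l]. }
  destruct (H (S n)) as (N & HN & HxN). rewrite S_INR in HN.
  pose proof (Rmax_l 1 (7 * y / (x - y))). pose proof (Rmax_r 1 (7 * y / (x - y))).
  assert (HN1 : 1 <= N) by lra.
  assert (Hz : 0 < / N <= 1).
  { split; [apply Rinv_0_lt_compat; lra|]. 
    assert (L : / N <= / 1) by (apply Rinv_le_contravar; lra). rewrite Rinv_1 in L. exact L. }
  replace ((N + 1) / N) with (1 + / N) in HxN by (field; lra).
  set (z := / N) in *.
  assert (Hc : (1 + z) ^ 3 <= 1 + 7 * z) by nra.
  assert (7 * z * y < x - y).
  { assert (7 * y / (x - y) < N) by lra.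
    apply Rmult_lt_compat_r with (r := z * (x - y)) in H2; [|apply Rmult_lt_0_compat; lra].
    replace (N * (z * (x - y))) with (x - y) in H2 by (unfold z; field; lra).
    replace (7 * y / (x - y) * (z * (x - y))) with (7 * z * y) in H2 by (field; lra).
    exact H2. }
  nra.
Qed.

(** * Wallis integrals and the value of Gamma at 1/2 *)

Definition wallis (n : nat) : R := RInt (fun x => sin x ^ n) 0 (PI / 2).

Lemma continuous_sin_pow n x : continuous (fun x => sin x ^ n) x.
Proof. apply (@ex_derive_continuous R_AbsRing R_NormedModule). now auto_derive. Qed.

Lemma ex_RInt_sin_pow n : ex_RInt (fun x => sin x ^ n) 0 (PI / 2).
Proof.
  apply (@ex_RInt_continuous R_CompleteNormedModule). intros; apply continuous_sin_pow.
Qed.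

Lemma wallis_0 : wallis 0 = PI / 2.
Proof.
  unfold wallis. simpl. rewrite (@RInt_const R_CompleteNormedModule).
  unfold scal; simpl; unfold mult; simpl. ring.
Qed.

Lemma wallis_1 : wallis 1 = 1.
Proof.
  unfold wallis. apply is_RInt_unique.
  replace 1 with (minus (- cos (PI / 2)) (- cos 0))
    by (rewrite cos_PI2, cos_0; unfold minus, plus, opp; simpl; ring).
  apply (@is_RInt_derive R_CompleteNormedModule (fun x => - cos x)); intros x _.
  - auto_derive; trivial. ring.
  - apply continuous_sin_pow.
Qed.

(* Integrate the derivative of [- cos x * sin x ^ (n + 1)], which vanishes at both ends. *)
Lemma wallis_rec n : (INR n + 2) * wallis (S (S n)) = (INR n + 1) * wallis n.
Proof.
  assert (H : is_RInt (fun x => (INR n + 2) * sin x ^ S (S n) - (INR n + 1) * sin x ^ n)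
    0 (PI / 2) (minus (- cos (PI / 2) * sin (PI / 2) ^ S n) (- cos 0 * sin 0 ^ S n))).
  { apply (@is_RInt_derive R_CompleteNormedModule (fun x => - cos x * sin x ^ S n)); intros x _.
    - auto_derive; trivial.
      change (match n with O => 1 | S _ => INR n + 1 end) with (INR (S n)). rewrite S_INR.
      simpl.
      pose proof (sin2_cos2 x) as E. unfold Rsqr in E.
      replace (sin x * (sin x * sin x ^ n)) with ((sin x * sin x) * sin x ^ n) by ring.
      replace (sin x * sin x) with (1 - cos x * cos x) by lra.
      ring_simplify. replace (sin x ^ 2) with (1 - cos x * cos x) by (simpl; lra). ring.
    - apply (@ex_derive_continuous R_AbsRing R_NormedModule). now auto_derive. }
  assert (H' : is_RInt (fun x => (INR n + 2) * sin x ^ S (S n) - (INR n + 1) * sin x ^ n)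
    0 (PI / 2) ((INR n + 2) * wallis (S (S n)) - (INR n + 1) * wallis n)).
  { apply (@is_RInt_minus R_NormedModule); apply (@is_RInt_scal R_NormedModule);
      apply (@RInt_correct R_CompleteNormedModule); apply ex_RInt_sin_pow. }
  pose proof (is_RInt_unique _ _ _ _ H) as E1. pose proof (is_RInt_unique _ _ _ _ H') as E2.
  rewrite E1 in E2. rewrite cos_PI2, sin_0 in E2.
  unfold minus, plus, opp in E2; simpl in E2. lra.
Qed.

Lemma wallis_decr n : wallis (S n) <= wallis n.
Proof.
  pose proof PI_RGT_0. apply RInt_le; [lra|apply ex_RInt_sin_pow|apply ex_RInt_sin_pow|].
  intros x Hx. simpl.
  assert (0 <= sin x) by (apply sin_ge_0; lra).
  pose proof (SIN_bound x). pose proof (pow_le (sin x) n ltac:(lra)). nra.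
Qed.

Lemma wallis_gt_0 n : 0 < wallis n.
Proof.
  pose proof PI_RGT_0. apply RInt_gt_0; [lra| |].
  - intros x Hx. apply pow_lt. apply sin_gt_0; lra.
  - intros; apply continuous_sin_pow.
Qed.

(** Since [b / a >= 1], its square root is at most [b / a]; the cruder bound keeps the error factors
    rational. *)
Lemma Rpower_half_le_ratio a b : 0 < a <= b -> Rpower b (1 / 2) <= b / a * Rpower a (1 / 2).
Proof.
  intros Hab.
  assert (E : Rpower b (1 / 2) = Rpower (b / a) (1 / 2) * Rpower a (1 / 2)).
  { rewrite Rpower_mult_distr; [|apply Rdiv_lt_0_compat; lra|lra]. f_equal. field. lra. }
  rewrite E. apply Rmult_le_compat_r; [left; apply Rpower_gt_0|].
  assert (1 <= b / a).
  { apply Rmult_le_reg_r with a; [lra|]. unfold Rdiv. rewrite Rmult_assoc, Rinv_l; lra. }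
  rewrite <- (Rpower_1 (b / a)) at 2 by lra. apply Rle_Rpower; lra.
Qed.

(** The classical formula [W_n = (sqrt PI / 2) Gamma ((n+1)/2) / Gamma (n/2 + 1)] says that this
    sequence is constant. Equality of its first two terms already gives [Gamma (1/2)^2 = PI]. *)
Definition wallis_gamma (n : nat) : R :=
  wallis n * (Gamma ((INR n + 1) / 2 + 1 / 2) / Gamma ((INR n + 1) / 2)).

Lemma wallis_gamma_gt_0 n : 0 < wallis_gamma n.
Proof.
  pose proof (pos_INR n).
  apply Rmult_lt_0_compat; [apply wallis_gt_0|].
  apply Rdiv_lt_0_compat; apply Gamma_gt_0; lra.
Qed.

Lemma wallis_gamma_step n : wallis_gamma (S (S n)) = wallis_gamma n.
Proof.
  unfold wallis_gamma. pose proof (pos_INR n). rewrite !S_INR.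
  replace ((INR n + 1 + 1 + 1) / 2 + 1 / 2) with (((INR n + 1) / 2 + 1 / 2) + 1) by field.
  replace ((INR n + 1 + 1 + 1) / 2) with ((INR n + 1) / 2 + 1) by field.
  rewrite !Gamma_plus_1 by lra.
  assert (E : wallis (S (S n)) = (INR n + 1) * wallis n / (INR n + 2))
    by (rewrite <- wallis_rec; field; lra).
  rewrite E. pose proof (Gamma_gt_0 ((INR n + 1) / 2) ltac:(lra)). field. lra.
Qed.

(** The Wallis integrals decrease, and Wendel's bounds replace the Gamma quotients by the square
    roots of [d] and [c], where [d / c = (N + 1) / N] with [N = n + 1]. The loss
    [(N + 1) (N + 2) / N^2] is below the cube. *)
Lemma wallis_gamma_le n : wallis_gamma (S n) <= ((INR n + 1 + 1) / (INR n + 1)) ^ 3 * wallis_gamma n.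
Proof.
  unfold wallis_gamma. rewrite S_INR. pose proof (pos_INR n).
  set (c := (INR n + 1) / 2). set (d := (INR n + 1 + 1) / 2).
  assert (Hcd : 0 < c <= d) by (unfold c, d; lra).
  pose proof (Gamma_plus_le d (1 / 2) ltac:(lra) ltac:(lra)) as H1.
  pose proof (Gamma_plus_ge c (1 / 2) ltac:(lra) ltac:(lra)) as H2.
  pose proof (Gamma_gt_0 c ltac:(lra)) as Gc. pose proof (Gamma_gt_0 d ltac:(lra)) as Gd.
  pose proof (Rpower_half_le_ratio c d Hcd) as H3.
  pose proof (wallis_decr n) as H4. pose proof (wallis_gt_0 n) as H5.
  pose proof (wallis_gt_0 (S n)) as H6.
  assert (B1 : Gamma (d + 1 / 2) / Gamma d <= Rpower d (1 / 2)).
  { apply Rmult_le_reg_r with (Gamma d); trivial. unfold Rdiv.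
    rewrite Rmult_assoc, Rinv_l; lra. }
  assert (B2 : c / (c + 1) * Rpower c (1 / 2) <= Gamma (c + 1 / 2) / Gamma c).
  { apply Rmult_le_reg_r with (Gamma c); trivial.
    replace (Gamma (c + 1 / 2) / Gamma c * Gamma c) with (Gamma (c + 1 / 2)) by (field; lra).
    lra. }
  assert (B3 : Rpower c (1 / 2) <= (c + 1) / c * (Gamma (c + 1 / 2) / Gamma c)).
  { apply Rmult_le_compat_l with (r := (c + 1) / c) in B2;
      [|left; apply Rdiv_lt_0_compat; lra].
    apply Rle_trans with (2 := B2). right. field. lra. }
  pose proof (Rpower_gt_0 c (1 / 2)). pose proof (Rpower_gt_0 d (1 / 2)).
  assert (Hq : 0 < Gamma (c + 1 / 2) / Gamma c)
    by (apply Rdiv_lt_0_compat; [apply Gamma_gt_0; lra|trivial]).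
  apply Rle_trans with (wallis n * (d / c * ((c + 1) / c * (Gamma (c + 1 / 2) / Gamma c)))).
  - apply Rle_trans with (wallis (S n) * Rpower d (1 / 2)).
    + apply Rmult_le_compat_l; lra.
    + apply Rmult_le_compat; try lra.
      apply Rle_trans with (1 := H3). apply Rmult_le_compat_l; trivial.
      left; apply Rdiv_lt_0_compat; lra.
  - set (q := Gamma (c + 1 / 2) / Gamma c) in *.
    replace (wallis n * (d / c * ((c + 1) / c * q)))
      with (d / c * ((c + 1) / c) * (wallis n * q)) by ring.
    apply Rmult_le_compat_r; [left; now apply Rmult_lt_0_compat|].
    unfold c, d. set (N := INR n + 1) in *. assert (0 < N) by (unfold N; lra).
    apply Rmult_le_reg_r with (N ^ 3); [now apply pow_lt|].
    replace (((N + 1) / N) ^ 3 * N ^ 3) with ((N + 1) ^ 3) by (field; lra).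
    replace ((N + 1) / 2 / (N / 2) * ((N / 2 + 1) / (N / 2)) * N ^ 3)
      with ((N + 1) * (N + 2) * N) by (field; lra).
    nra.
Qed.

Lemma Gamma_half : Gamma (1 / 2) = sqrt PI.
Proof.
  assert (E0 : forall m, wallis_gamma (2 * m) = wallis_gamma 0%nat).
  { induction m; trivial. replace (2 * S m)%nat with (S (S (2 * m))) by lia.
    now rewrite wallis_gamma_step. }
  assert (E1 : forall m, wallis_gamma (S (2 * m)) = wallis_gamma 1%nat).
  { induction m; trivial. replace (S (2 * S m)) with (S (S (S (2 * m)))) by lia.
    now rewrite wallis_gamma_step. }
  (* The one-sided estimate gives both inequalities: a step from odd to even index for one, from
     even to odd for the other. *)
  assert (E : wallis_gamma 0%nat = wallis_gamma 1%nat).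
  { apply Rle_antisym.
    - apply le_of_le_mul_cubes; [apply wallis_gamma_gt_0|]. intros n.
      exists (INR (S (2 * n)) + 1). split.
      + pose proof (pos_INR n). rewrite S_INR, mult_INR; simpl; lra.
      + rewrite <- (E1 n), <- (E0 (S n)).
        replace (2 * S n)%nat with (S (S (2 * n))) by lia. apply wallis_gamma_le.
    - apply le_of_le_mul_cubes; [apply wallis_gamma_gt_0|]. intros n.
      exists (INR (2 * n) + 1). split.
      + pose proof (pos_INR n). rewrite mult_INR; simpl; lra.
      + rewrite <- (E1 n), <- (E0 n). apply wallis_gamma_le. }
  unfold wallis_gamma in E. rewrite wallis_0, wallis_1 in E. simpl in E.
  replace ((0 + 1) / 2 + 1 / 2) with 1 in E by field.
  replace ((1 + 1) / 2 + 1 / 2) with (1 / 2 + 1) in E by field.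
  replace ((1 + 1) / 2) with 1 in E by field.
  replace ((0 + 1) / 2) with (1 / 2) in E by field.
  rewrite Gamma_plus_1, Gamma_1 in E by lra.
  pose proof (Gamma_gt_0 (1 / 2) ltac:(lra)) as Hg.
  symmetry. apply sqrt_lem_1; [pose proof PI_RGT_0; lra|lra|].
  apply Rmult_eq_compat_r with (r := 2 * Gamma (1 / 2)) in E. field_simplify in E; [|lra]. lra.
Qed.

(** * Legendre's duplication formula *)

Definition dup_ratio (s : R) : R := Rpower 2 s * Gamma (s / 2) * Gamma ((s + 1) / 2) / Gamma s.

Lemma dup_ratio_gt_0 s : 0 < s -> 0 < dup_ratio s.
Proof.
  intros Hs. apply Rdiv_lt_0_compat; [|apply Gamma_gt_0; lra].
  repeat apply Rmult_lt_0_compat; try apply Rpower_gt_0; apply Gamma_gt_0; lra.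
Qed.

Lemma dup_ratio_step s : 0 < s -> dup_ratio (s + 1) = dup_ratio s.
Proof.
  intros Hs. unfold dup_ratio.
  replace ((s + 1 + 1) / 2) with (s / 2 + 1) by field.
  rewrite Rpower_plus, Rpower_1 by lra. rewrite !Gamma_plus_1 by lra.
  pose proof (Gamma_gt_0 s Hs). field. lra.
Qed.

Lemma dup_ratio_steps s n : 0 < s -> dup_ratio (s + INR n) = dup_ratio s.
Proof.
  intros Hs. induction n as [|n IH].
  - simpl. now rewrite Rplus_0_r.
  - rewrite S_INR, <- Rplus_assoc, dup_ratio_step; trivial. pose proof (pos_INR n); lra.
Qed.

(** Replacing each [Gamma (a + r)] by [a^r Gamma a], and likewise at [2 a], removes [s] altogether,
    because [2^s a^(s/2) a^((s+1)/2) = (2 a)^s a^(1/2)]; [c] is what remains. The restriction to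
    [s <= 1] keeps the three steps within Wendel's range. *)
Lemma dup_ratio_bounds s a : 0 < s <= 1 -> 0 < a ->
  let c := Rpower 2 (2 * a) * Rpower a (1 / 2) * Gamma a ^ 2 / Gamma (2 * a) in
  (a / (a + 1)) ^ 2 * c <= dup_ratio (s + 2 * a) <= (a + 1) / a * c.
Proof.
  intros Hs Ha c.
  pose proof (Gamma_gt_0 a Ha) as Ga. pose proof (Gamma_gt_0 (2 * a) ltac:(lra)) as G2a.
  pose proof (Gamma_gt_0 (2 * a + s) ltac:(lra)) as G2as.
  pose proof (Gamma_gt_0 (a + s / 2) ltac:(lra)) as Gas.
  pose proof (Gamma_gt_0 (a + (s + 1) / 2) ltac:(lra)) as Gas1.
  pose proof (Gamma_plus_le a (s / 2) ltac:(lra) ltac:(lra)) as U1.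
  pose proof (Gamma_plus_ge a (s / 2) ltac:(lra) ltac:(lra)) as L1.
  pose proof (Gamma_plus_le a ((s + 1) / 2) ltac:(lra) ltac:(lra)) as U2.
  pose proof (Gamma_plus_ge a ((s + 1) / 2) ltac:(lra) ltac:(lra)) as L2.
  pose proof (Gamma_plus_le (2 * a) s ltac:(lra) ltac:(lra)) as U3.
  pose proof (Gamma_plus_ge (2 * a) s ltac:(lra) ltac:(lra)) as L3.
  set (P1 := Rpower a (s / 2)) in *. set (P2 := Rpower a ((s + 1) / 2)) in *.
  set (P3 := Rpower (2 * a) s) in *.
  assert (HP1 : 0 < P1) by apply Rpower_gt_0. assert (HP2 : 0 < P2) by apply Rpower_gt_0.
  assert (HP3 : 0 < P3) by apply Rpower_gt_0.
  set (T := Rpower 2 (2 * a)). assert (HT : 0 < T) by apply Rpower_gt_0.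
  assert (EP : Rpower 2 s * P1 * P2 = P3 * Rpower a (1 / 2)).
  { unfold P1, P2, P3. rewrite <- Rpower_mult_distr by lra.
    rewrite !Rmult_assoc, <- !Rpower_plus. do 2 f_equal. field. }
  assert (Eh : dup_ratio (s + 2 * a)
    = Rpower 2 s * T * (Gamma (a + s / 2) * Gamma (a + (s + 1) / 2)) / Gamma (2 * a + s)).
  { unfold dup_ratio, T. rewrite Rpower_plus.
    replace ((s + 2 * a) / 2) with (a + s / 2) by field.
    replace ((s + 2 * a + 1) / 2) with (a + (s + 1) / 2) by field.
    replace (s + 2 * a) with (2 * a + s) by ring. unfold Rdiv. ring. }
  pose proof (Rpower_gt_0 2 s) as H2s.
  assert (Ha1 : 0 < a / (a + 1)) by (apply Rdiv_lt_0_compat; lra).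
  assert (Ec : c = Rpower 2 s * T * (P1 * P2 * Gamma a ^ 2) / (P3 * Gamma (2 * a))).
  { unfold c. fold T.
    replace (Rpower 2 s * T * (P1 * P2 * Gamma a ^ 2))
      with (Rpower 2 s * P1 * P2 * (T * Gamma a ^ 2)) by ring.
    rewrite EP. field. lra. }
  rewrite Eh, Ec. split.
  - replace ((a / (a + 1)) ^ 2 * (Rpower 2 s * T * (P1 * P2 * Gamma a ^ 2) / (P3 * Gamma (2 * a))))
      with (Rpower 2 s * T * ((a / (a + 1) * (P1 * Gamma a)) * (a / (a + 1) * (P2 * Gamma a)))
        * / (P3 * Gamma (2 * a))) by (field; lra).
    set (k := a / (a + 1)) in *. clearbody k.
    match goal with |- _ <= ?X / ?Y => change (X / Y) with (X * / Y) end.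
    apply Rmult_le_compat.
    + repeat apply Rmult_le_pos; lra.
    + left. apply Rinv_0_lt_compat. now apply Rmult_lt_0_compat.
    + apply Rmult_le_compat_l; [left; now apply Rmult_lt_0_compat|].
      apply Rmult_le_compat; trivial; repeat apply Rmult_le_pos; lra.
    + apply Rinv_le_contravar; trivial.
  (* The natural factor [2 a / (2 a + 1)] is weakened to [a / (a + 1)], so that upper and lower
     bounds differ exactly by the cube of [(a + 1) / a]. *)
  - assert (HL3 : a / (a + 1) * (P3 * Gamma (2 * a)) <= Gamma (2 * a + s)).
    { apply Rle_trans with (2 := L3). apply Rmult_le_compat_r.
      - left; now apply Rmult_lt_0_compat.
      - apply Rmult_le_reg_r with ((a + 1) * (2 * a + 1)); [nra|].
        replace (a / (a + 1) * ((a + 1) * (2 * a + 1))) with (a * (2 * a + 1)) by (field; lra).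
        replace (2 * a / (2 * a + 1) * ((a + 1) * (2 * a + 1))) with (2 * a * (a + 1))
          by (field; lra). nra. }
    replace ((a + 1) / a * (Rpower 2 s * T * (P1 * P2 * Gamma a ^ 2) / (P3 * Gamma (2 * a))))
      with (Rpower 2 s * T * ((P1 * Gamma a) * (P2 * Gamma a))
        * / (a / (a + 1) * (P3 * Gamma (2 * a)))) by (field; lra).
    set (k := a / (a + 1)) in *. clearbody k.
    match goal with |- ?X / ?Y <= _ => change (X / Y) with (X * / Y) end.
    apply Rmult_le_compat.
    + repeat apply Rmult_le_pos; lra.
    + left. now apply Rinv_0_lt_compat.
    + apply Rmult_le_compat_l; [left; now apply Rmult_lt_0_compat|].
      apply Rmult_le_compat; lra.
    + apply Rinv_le_contravar; trivial. repeat apply Rmult_lt_0_compat; lra.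
Qed.

Lemma dup_ratio_le s s' : 0 < s <= 1 -> 0 < s' <= 1 -> dup_ratio s <= dup_ratio s'.
Proof.
  intros Hs Hs'. apply le_of_le_mul_cubes; [now apply dup_ratio_gt_0|].
  intros n. set (a := INR (S n)).
  assert (Ha : 0 < a) by (unfold a; rewrite S_INR; pose proof (pos_INR n); lra).
  exists a. split; [unfold a; rewrite S_INR; lra|].
  rewrite <- (dup_ratio_steps s (2 * S n)), <- (dup_ratio_steps s' (2 * S n)) by lra.
  rewrite mult_INR. fold a. change (INR 2) with 2.
  destruct (dup_ratio_bounds s a Hs Ha) as [_ H1].
  destruct (dup_ratio_bounds s' a Hs' Ha) as [H2 _].
  apply Rle_trans with (1 := H1).
  apply Rmult_le_compat_l with (r := ((a + 1) / a) ^ 3) in H2.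
  2:{ left. apply pow_lt. apply Rdiv_lt_0_compat; lra. }
  apply Rle_trans with (2 := H2). right. field.
  pose proof (Gamma_gt_0 (2 * a) ltac:(lra)). lra.
Qed.

Lemma Gamma_duplication s : 0 < s ->
  Rpower 2 s * Gamma (s / 2) * Gamma ((s + 1) / 2) = 2 * sqrt PI * Gamma s.
Proof.
  intros Hs.
  (* On [(0, 1]] the comparison works in both directions; periodicity extends it one unit interval
     at a time. At [s = 1] the ratio is [2 Gamma (1/2)]. *)
  assert (H : forall n s, 0 < s <= INR n + 1 -> dup_ratio s = dup_ratio 1).
  { induction n as [|n IH]; intros s' Hs'.
    - simpl in Hs'. apply Rle_antisym; apply dup_ratio_le; lra.
    - destruct (Rle_lt_dec s' 1).
      + apply Rle_antisym; apply dup_ratio_le; lra.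
      + rewrite S_INR in Hs'. replace s' with ((s' - 1) + 1) by ring.
        rewrite dup_ratio_step by lra. apply IH. lra. }
  destruct (nfloor_ex s ltac:(lra)) as [n Hn].
  specialize (H n s ltac:(lra)). unfold dup_ratio in H.
  replace ((1 + 1) / 2) with 1 in H by field.
  rewrite Gamma_half, Gamma_1, Rpower_1 in H by lra.
  pose proof (Gamma_gt_0 s Hs).
  apply Rmult_eq_compat_r with (r := Gamma s) in H. field_simplify in H; [|lra]. lra.
Qed.

(** * Kummer series and Gaussian Mellin integrals *)

Lemma poch_shift a k : poch a (S k) = a * poch (a + 1) k.
Proof.
  induction k as [|k IH]; [simpl; ring|].
  change (poch a (S (S k))) with (poch a (S k) * (a + INR (S k))).
  rewrite IH, S_INR. simpl. ring.
Qed.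

Lemma poch_gt_0 a k : 0 < a -> 0 < poch a k.
Proof.
  intros Ha. induction k as [|k IH]; simpl; [lra|].
  apply Rmult_lt_0_compat; trivial. pose proof (pos_INR k); lra.
Qed.

Lemma INR_fact_gt_0 k : 0 < INR (fact k).
Proof. apply lt_0_INR, lt_O_fact. Qed.

Lemma INR_fact_S k : INR (fact (S k)) = (INR k + 1) * INR (fact k).
Proof. rewrite fact_simpl, mult_INR, S_INR. reflexivity. Qed.

(** The even factors of [(2k)!] give [2^k k!], the odd ones [2^k (1/2)_k]. This and [fact_odd]
    produce the Kummer denominators from the exponential series. *)
Lemma fact_even k : INR (fact (2 * k)) = poch (1 / 2) k * INR (fact k) * 4 ^ k.
Proof.
  induction k as [|k IH]; [simpl; ring|].
  replace (2 * S k)%nat with (S (S (2 * k))) by lia.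
  rewrite !INR_fact_S, IH, S_INR, mult_INR. simpl. field.
Qed.

Lemma fact_odd k : INR (fact (2 * k + 1)) = poch (3 / 2) k * INR (fact k) * 4 ^ k.
Proof.
  induction k as [|k IH]; [simpl; ring|].
  replace (2 * S k + 1)%nat with (S (S (2 * k + 1))) by lia.
  rewrite !INR_fact_S, IH, S_INR, plus_INR, mult_INR. simpl. field.
Qed.

Definition kummer_term (a b z : R) (k : nat) : R :=
  poch a k / poch b k * z ^ k / INR (fact k).

Lemma ex_series_exp y : ex_series (fun k => y ^ k / INR (fact k)).
Proof.
  exists (exp y). eapply is_series_ext; [|apply (is_exp_Reals y)].
  intros k; simpl. rewrite pow_n_pow. unfold scal; simpl; unfold mult; simpl. reflexivity.
Qed.

(** Each factor [|a + k| / (b + k)] is at most [2 |a| + 1], so an exponential series dominates. *)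
Lemma ex_series_kummer a b z : 1 / 2 <= b -> ex_series (kummer_term a b z).
Proof.
  intros Hb. apply (@ex_series_le R_AbsRing R_CompleteNormedModule)
    with (b := fun k => ((2 * Rabs a + 1) * Rabs z) ^ k / INR (fact k)); [|apply ex_series_exp].
  intros k. change (norm (kummer_term a b z k)) with (Rabs (kummer_term a b z k)).
  unfold kummer_term, Rdiv. rewrite !Rabs_mult, !Rabs_inv, Rpow_mult_distr, RPow_abs.
  rewrite (Rabs_pos_eq (INR _)) by apply pos_INR.
  apply Rmult_le_compat_r; [left; apply Rinv_0_lt_compat, INR_fact_gt_0|].
  apply Rmult_le_compat_r; [apply Rabs_pos|].
  rewrite (Rabs_pos_eq (poch b k)) by (left; apply poch_gt_0; lra).
  apply Rmult_le_reg_r with (poch b k); [apply poch_gt_0; lra|].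
  rewrite Rmult_assoc, Rinv_l, Rmult_1_r by (apply Rgt_not_eq, poch_gt_0; lra).
  induction k as [|k IH]; simpl; [rewrite Rabs_R1; lra|].
  rewrite Rabs_mult.
  replace ((2 * Rabs a + 1) * (2 * Rabs a + 1) ^ k * (poch b k * (b + INR k)))
    with (((2 * Rabs a + 1) ^ k * poch b k) * ((2 * Rabs a + 1) * (b + INR k))) by ring.
  apply Rmult_le_compat; try apply Rabs_pos; trivial.
  apply Rle_trans with (1 := Rabs_triang _ _).
  rewrite (Rabs_pos_eq (INR k)) by apply pos_INR.
  pose proof (pos_INR k). pose proof (Rabs_pos a). nra.
Qed.

Lemma is_series_kummer a b z : 1 / 2 <= b -> is_series (kummer_term a b z) (kummerM a b z).
Proof. intros Hb. apply Series_correct. now apply ex_series_kummer. Qed.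

Lemma kummerM_0_l b z : 1 / 2 <= b -> kummerM 0 b z = 1.
Proof.
  intros Hb. change (kummerM 0 b z) with (Series (kummer_term 0 b z)).
  rewrite Series_incr_1 by now apply ex_series_kummer.
  rewrite (Series_ext _ (fun k => 0 * 0)).
  - rewrite Series_scal_l. unfold kummer_term; simpl. field.
  - intros k. unfold kummer_term. rewrite poch_shift. unfold Rdiv. ring.
Qed.

(** Compare coefficients: [(a)_(k+1) - (a-1)_(k+1) = (k + 1) (a)_k], and
    [(1/2)_(k+1) = (1/2) (3/2)_k]. *)
Lemma kummerM_contiguous_a a z :
  kummerM (a - 1) (1 / 2) z = kummerM a (1 / 2) z - 2 * z * kummerM a (3 / 2) z.
Proof.
  change (Series (kummer_term (a - 1) (1 / 2) z)
    = Series (kummer_term a (1 / 2) z) - 2 * z * Series (kummer_term a (3 / 2) z)).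
  rewrite (Series_incr_1 (kummer_term (a - 1) (1 / 2) z)) by (apply ex_series_kummer; lra).
  rewrite (Series_incr_1 (kummer_term a (1 / 2) z)) by (apply ex_series_kummer; lra).
  rewrite <- Series_scal_l. unfold Rminus at 3. rewrite Rplus_assoc.
  replace (kummer_term (a - 1) (1 / 2) z 0) with (kummer_term a (1 / 2) z 0) by reflexivity.
  f_equal. fold (Rminus (Series (fun k => kummer_term a (1 / 2) z (S k)))
    (Series (fun k => 2 * z * kummer_term a (3 / 2) z k))).
  rewrite <- Series_minus.
  - apply Series_ext. intros k. unfold kummer_term.
    rewrite (poch_shift (a - 1)), (poch_shift (1 / 2)), INR_fact_S.
    replace (a - 1 + 1) with a by ring. replace (1 / 2 + 1) with (3 / 2) by field.
    simpl poch. simpl pow. field.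
    pose proof (INR_fact_gt_0 k). pose proof (poch_gt_0 (3 / 2) k ltac:(lra)). pose proof (pos_INR k).
    lra.
  - apply (ex_series_incr_1 (kummer_term a (1 / 2) z)). apply ex_series_kummer; lra.
  - apply (@ex_series_scal_l R_AbsRing R_NormedModule (2 * z)). apply ex_series_kummer; lra.
Qed.

Lemma poch_three_halves k : poch (3 / 2) k = (1 + 2 * INR k) * poch (1 / 2) k.
Proof.
  apply Rmult_eq_reg_l with (1 / 2); [|lra].
  replace (3 / 2) with (1 / 2 + 1) by field. rewrite <- poch_shift. simpl. field.
Qed.

(** Since [a (a+1)_k = (a)_k (a + k)], the coefficients on the right add up to [1 + 2 k], which is
    [(3/2)_k / (1/2)_k]. *)
Lemma kummerM_contiguous_b a z :
  kummerM a (1 / 2) z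
  = (1 - 2 * a) * kummerM a (3 / 2) z + 2 * a * kummerM (a + 1) (3 / 2) z.
Proof.
  change (Series (kummer_term a (1 / 2) z)
    = (1 - 2 * a) * Series (kummer_term a (3 / 2) z)
      + 2 * a * Series (kummer_term (a + 1) (3 / 2) z)).
  rewrite <- !Series_scal_l, <- Series_plus.
  - apply Series_ext. intros k. unfold kummer_term.
    assert (E : 2 * a * (poch (a + 1) k / poch (3 / 2) k * z ^ k / INR (fact k))
      = 2 * poch a (S k) / poch (3 / 2) k * z ^ k / INR (fact k))
      by (rewrite poch_shift; unfold Rdiv; ring).
    rewrite E, poch_three_halves. simpl poch.
    pose proof (INR_fact_gt_0 k). pose proof (poch_gt_0 (1 / 2) k ltac:(lra)). pose proof (pos_INR k).
    field. lra.
  - apply (@ex_series_scal_l R_AbsRing R_NormedModule (1 - 2 * a)). apply ex_series_kummer; lra.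
  - apply (@ex_series_scal_l R_AbsRing R_NormedModule (2 * a)). apply ex_series_kummer; lra.
Qed.

(** * Mellin integrals of the Gaussian kernel and their expansion in [x] *)

Definition appell_kernel (x t u : R) : R := exp (- u * x - u ^ 2 / 2 * t).

Lemma continuous_appell_kernel x t u : continuous (appell_kernel x t) u.
Proof.
  apply (@ex_derive_continuous R_AbsRing R_NormedModule). unfold appell_kernel. now auto_derive.
Qed.

Lemma exp_decay_appell_kernel x t : 0 < t -> exp_decay (appell_kernel x t).
Proof.
  (* Completing the square: the maximum of [u - u x - t u^2 / 2] is [(1 - x)^2 / (2 t)], at
     [u = (1 - x) / t]. *)
  intros Ht. apply (exp_decay_le _ 1 (exp ((1 - x) ^ 2 / (2 * t)))); [lra| |].
  - apply continuous_appell_kernel.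
  - intros u _. unfold appell_kernel. rewrite Rabs_pos_eq by (left; apply exp_pos).
    rewrite <- exp_plus. apply exp_le_exp.
    assert (E : (1 - x) ^ 2 / (2 * t) + - (1 * u) - (- u * x - u ^ 2 / 2 * t)
      = (1 - x - t * u) ^ 2 / (2 * t)) by (field; lra).
    assert (0 <= (1 - x - t * u) ^ 2 / (2 * t)).
    { apply Rmult_le_pos; [apply pow2_ge_0|left; apply Rinv_0_lt_compat; lra]. }
    lra.
Qed.

Lemma is_int_0oo_comp_square (f : R -> R) t l : 0 < t ->
  (forall u, 0 < u -> continuous f u) -> is_int_0oo f l ->
  is_int_0oo (fun u => t * u * f (t * u ^ 2 / 2)) l.
Proof.
  intros Ht Hf Hl.
  set (g := fun u => t * u ^ 2 / 2).
  assert (Hg : forall u, is_derive g u (t * u)) by (intros u; unfold g; auto_derive; trivial; field).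
  assert (Hgp : forall u, 0 < u -> 0 < g u).
  { intros u Hu. unfold g. apply Rdiv_lt_0_compat; [|lra].
    apply Rmult_lt_0_compat; trivial. now apply pow_lt. }
  assert (Hdg : forall u, continuous (fun u => t * u) u).
  { intros u. apply (@continuous_scal_r R_UniformSpace R_AbsRing R_NormedModule). apply continuous_id. }
  apply is_int_0oo_intro.
  - intros u Hu. apply (@continuous_mult R_UniformSpace R_AbsRing); [apply Hdg|].
    apply (continuous_comp g f).
    + apply (@ex_derive_continuous R_AbsRing R_NormedModule). eexists; apply Hg.
    + apply Hf. auto.
  - intros eps Heps. destruct (is_int_0oo_elim f l Hl eps Heps) as (A & B & HA & HB & H).
    (* Cutting off at 1 avoids square roots: [a^2 <= a] for [a <= 1] and [b <= b^2] for [b >= 1]. *)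
    exists (Rmin 1 (2 * A / t)), (Rmax 1 (2 * B / t)).
    assert (0 < 2 * A / t) by (apply Rdiv_lt_0_compat; lra).
    split; [apply Rmin_glb_lt; lra|].
    split; [apply Rlt_le_trans with 1; [lra|apply Rmax_l]|].
    intros a b Ha Hb.
    pose proof (Rmin_l 1 (2 * A / t)). pose proof (Rmin_r 1 (2 * A / t)).
    pose proof (Rmax_l 1 (2 * B / t)). pose proof (Rmax_r 1 (2 * B / t)).
    assert (E : RInt (fun u => t * u * f (g u)) a b = RInt f (g a) (g b)).
    { apply (@RInt_comp R_CompleteNormedModule f g (fun u => t * u)).
      - intros u [Hu _]. apply Hf, Hgp. apply Rlt_le_trans with (2 := Hu). apply Rmin_glb_lt; lra.
      - intros u _. split; [apply Hg|apply Hdg]. }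
    change (Rabs (RInt (fun u => t * u * f (g u)) a b - l) < eps). rewrite E.
    apply H.
    + split; [apply Hgp; lra|]. unfold g.
      assert (t * a <= 2 * A).
      { replace (2 * A) with (t * (2 * A / t)) by (field; lra). apply Rmult_le_compat_l; lra. }
      nra.
    + unfold g. assert (2 * B <= t * b).
      { replace (2 * B) with (t * (2 * B / t)) by (field; lra). apply Rmult_le_compat_l; lra. }
      nra.
Qed.

Lemma mellin_gauss s t : 0 < s -> 0 < t ->
  mellin s (appell_kernel 0 t) = 1 / 2 * Rpower (2 / t) (s / 2) * Gamma (s / 2).
Proof.
  intros Hs Ht.
  (* Under [v = t u^2 / 2], [v^(s/2-1) dv] becomes [2 (t/2)^(s/2) u^(s-1) du]. *)
  assert (H : is_int_0oo (fun u => 2 * Rpower (t / 2) (s / 2)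
      * (Rpower u (s - 1) * appell_kernel 0 t u)) (Gamma (s / 2))).
  { eapply is_int_0oo_ext; [|apply (is_int_0oo_comp_square _ t _ Ht
      (fun u Hu => continuous_mellin_kernel (s / 2) (fun u => exp (- u)) u
        (proj1 exp_decay_exp) Hu) (Gamma_correct (s / 2) ltac:(lra)))].
    intros u Hu; cbv beta.
    replace (appell_kernel 0 t u) with (exp (- (t * u ^ 2 / 2)))
      by (unfold appell_kernel; f_equal; field).
    replace (t * u ^ 2 / 2) with (t / 2 * (u * u)) at 1 by field.
    rewrite <- !Rpower_mult_distr; try lra; [|apply Rmult_lt_0_compat; lra].
    rewrite <- Rpower_plus.
    replace (s / 2 - 1 + (s / 2 - 1)) with ((s - 1) + - (1)) by field.
    unfold Rminus at 1. rewrite !Rpower_plus, !Rpower_Ropp, !Rpower_1 by lra.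
    field. lra. }
  pose proof (is_int_0oo_unique _ _ _ H (is_int_0oo_scal _ (2 * Rpower (t / 2) (s / 2)) _
    (mellin_correct s _ Hs (exp_decay_appell_kernel 0 t Ht)))) as E.
  rewrite E. replace (2 / t) with (/ (t / 2)) by (field; lra).
  assert (Er : Rpower (/ (t / 2)) (s / 2) * Rpower (t / 2) (s / 2) = 1).
  { rewrite Rpower_mult_distr; [|apply Rinv_0_lt_compat; lra|lra].
    rewrite Rinv_l by lra. unfold Rpower. rewrite ln_1, Rmult_0_r. apply exp_0. }
  transitivity (Rpower (/ (t / 2)) (s / 2) * Rpower (t / 2) (s / 2) * mellin s (appell_kernel 0 t)).
  - rewrite Er. ring.
  - field.
Qed.

Lemma mellin_gauss_step s t : 0 < s -> 0 < t ->
  mellin (s + 2) (appell_kernel 0 t) = s / t * mellin s (appell_kernel 0 t).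
Proof.
  intros Hs Ht. rewrite !mellin_gauss by lra.
  replace ((s + 2) / 2) with (s / 2 + 1) by field.
  rewrite Gamma_plus_1, Rpower_plus, Rpower_1 by (try apply Rdiv_lt_0_compat; lra).
  field. lra.
Qed.

Lemma mellin_gauss_steps s t k : 0 < s -> 0 < t ->
  mellin (s + INR (2 * k)) (appell_kernel 0 t)
  = poch (s / 2) k * (2 / t) ^ k * mellin s (appell_kernel 0 t).
Proof.
  intros Hs Ht. induction k as [|k IH].
  - simpl. rewrite Rplus_0_r. ring.
  - replace (INR (2 * S k)) with (INR (2 * k) + 2) by (rewrite !mult_INR, (S_INR k); simpl; ring).
    rewrite <- Rplus_assoc, mellin_gauss_step, IH by (try assumption; pose proof (pos_INR (2 * k)); lra).
    rewrite mult_INR. simpl. field. lra.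
Qed.

Lemma exp_decay_pow_mul k (h : R -> R) : exp_decay h -> exp_decay (fun u => u ^ k * h u).
Proof.
  intros Hh. induction k as [|k IH].
  - apply exp_decay_ext with (2 := Hh). intros; simpl; ring.
  - apply exp_decay_ext with (2 := exp_decay_mul_id _ IH). intros; simpl; ring.
Qed.

Lemma mellin_pow_mul k s (h : R -> R) : 0 < s -> exp_decay h ->
  mellin s (fun u => u ^ k * h u) = mellin (s + INR k) h.
Proof.
  intros Hs Hh. revert s Hs. induction k as [|k IH]; intros s Hs.
  - simpl INR. rewrite Rplus_0_r. apply mellin_ext; trivial.
    + now apply (exp_decay_pow_mul 0).
    + intros; simpl; ring.
  - rewrite S_INR. replace (s + (INR k + 1)) with (s + 1 + INR k) by ring.
    rewrite <- IH, <- mellin_mul_id by (trivial; try lra; now apply exp_decay_pow_mul).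
    apply mellin_ext; trivial.
    + now apply exp_decay_pow_mul.
    + intros; simpl; ring.
Qed.

Lemma mellin_exp_partial_sum s c n (h : R -> R) : 0 < s -> exp_decay h ->
  exp_decay (fun u => sum_f_R0 (fun m => (u * c) ^ m / INR (fact m)) n * h u) /\
  mellin s (fun u => sum_f_R0 (fun m => (u * c) ^ m / INR (fact m)) n * h u)
  = sum_f_R0 (fun m => c ^ m / INR (fact m) * mellin (s + INR m) h) n.
Proof.
  intros Hs Hh. induction n as [|n [IHd IH]].
  - simpl. split.
    + apply exp_decay_ext with (2 := Hh). intros; field.
    + rewrite Rplus_0_r. replace (1 / 1 * mellin s h) with (mellin s h) by field.
      symmetry. apply mellin_ext; trivial. intros; field.
  - assert (E : forall u, sum_f_R0 (fun m => (u * c) ^ m / INR (fact m)) n * h u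
        + c ^ S n / INR (fact (S n)) * (u ^ S n * h u)
        = sum_f_R0 (fun m => (u * c) ^ m / INR (fact m)) (S n) * h u).
    { intros u. rewrite tech5, Rpow_mult_distr. unfold Rdiv. ring. }
    pose proof (exp_decay_pow_mul (S n) h Hh) as Hp.
    pose proof (exp_decay_scal _ (c ^ S n / INR (fact (S n))) Hp) as Hps.
    split.
    + exact (exp_decay_ext _ _ E (exp_decay_plus _ _ IHd Hps)).
    + rewrite tech5, <- IH, <- mellin_pow_mul, <- mellin_scal, <- mellin_plus by trivial.
      symmetry. apply mellin_ext; trivial.
      now apply exp_decay_plus.
Qed.

Lemma pow_div_fact_le_exp y n : 0 <= y -> y ^ n / INR (fact n) <= exp y.
Proof.
  intros Hy. apply Rle_trans with (2 := exp_ge_taylor y n Hy).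
  destruct n as [|n]; [simpl; lra|]. rewrite tech5.
  assert (0 <= sum_f_R0 (fun k => y ^ k / INR (fact k)) n); [|lra].
  apply cond_pos_sum. intros k. apply Rmult_le_pos; [now apply pow_le|].
  left. apply Rinv_0_lt_compat, INR_fact_gt_0.
Qed.

Lemma Derive_n_exp_scal c n u : Derive_n (fun v => exp (v * c)) n u = c ^ n * exp (u * c).
Proof.
  revert u. induction n as [|n IH]; intros u; [simpl; ring|].
  simpl. rewrite (Derive_ext _ _ _ IH). apply is_derive_unique.
  auto_derive; trivial. ring.
Qed.

Lemma ex_derive_n_exp_scal c n u : ex_derive_n (fun v => exp (v * c)) n u.
Proof.
  destruct n as [|n]; [exact I|]. simpl.
  apply ex_derive_ext with (f := fun v => c ^ n * exp (v * c)).
  - intros v. now rewrite Derive_n_exp_scal.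
  - now auto_derive.
Qed.

(** In Lagrange's remainder with [y = u |c|], write [y^(n+1) / (n+1)!] as [2^-(n+1) (2y)^(n+1) /
    (n+1)! <= 2^-(n+1) exp (2 y)]; the intermediate exponential adds another [exp y]. The geometric
    factor is uniform in [u], and [exp (3 y)] is integrable against the Gaussian. *)
Lemma exp_taylor_remainder c n u : 0 < u ->
  Rabs (exp (u * c) - sum_f_R0 (fun m => (u * c) ^ m / INR (fact m)) n)
  <= (/ 2) ^ S n * exp (3 * Rabs c * u).
Proof.
  intros Hu.
  destruct (Taylor_Lagrange (fun v => exp (v * c)) n 0 u Hu) as (z & Hz & E).
  { intros v _ k _. apply ex_derive_n_exp_scal. }
  rewrite E.
  assert (Es : sum_f_R0 (fun m => (u - 0) ^ m / INR (fact m)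
      * Derive_n (fun v => exp (v * c)) m 0) n
      = sum_f_R0 (fun m => (u * c) ^ m / INR (fact m)) n).
  { apply sum_eq. intros m _. rewrite Derive_n_exp_scal, Rminus_0_r, Rmult_0_l, exp_0, Rpow_mult_distr.
    unfold Rdiv. ring. }
  rewrite Es, Derive_n_exp_scal, Rminus_0_r.
  set (S0 := sum_f_R0 _ n).
  replace (S0 + u ^ S n / INR (fact (S n)) * (c ^ S n * exp (z * c)) - S0)
    with ((u ^ S n * c ^ S n) * / INR (fact (S n)) * exp (z * c)) by (unfold Rdiv; ring).
  pose proof (INR_fact_gt_0 (S n)) as Hf. pose proof (Rinv_0_lt_compat _ Hf) as Hf'.
  rewrite <- Rpow_mult_distr, !Rabs_mult, <- RPow_abs, Rabs_mult.
  rewrite (Rabs_pos_eq (/ _)), (Rabs_pos_eq (exp _)), (Rabs_pos_eq u)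
    by (try apply Rlt_le, exp_pos; lra).
  pose proof (Rabs_pos c) as Hc.
  replace (exp (3 * Rabs c * u)) with (exp (2 * (u * Rabs c)) * exp (u * Rabs c))
    by (rewrite <- exp_plus; f_equal; ring).
  rewrite <- Rmult_assoc. apply Rmult_le_compat.
  - apply Rmult_le_pos; [apply pow_le, Rmult_le_pos; lra|lra].
  - left; apply exp_pos.
  - pose proof (pow_div_fact_le_exp (2 * (u * Rabs c)) (S n) ltac:(nra)) as H.
    apply Rmult_le_compat_l with (r := (/ 2) ^ S n) in H; [|apply pow_le; lra].
    apply Rle_trans with (2 := H). right. unfold Rdiv.
    rewrite <- Rmult_assoc, <- Rpow_mult_distr. do 2 f_equal. field.
  - apply exp_le_exp. pose proof (Rle_abs c).
    apply Rle_trans with (z * Rabs c).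
    + apply Rmult_le_compat_l; lra.
    + apply Rmult_le_compat_r; lra.
Qed.

Lemma is_series_mellin_appell_kernel s x t : 0 < s -> 0 < t ->
  is_series (fun m => (- x) ^ m / INR (fact m) * mellin (s + INR m) (appell_kernel 0 t))
    (mellin s (appell_kernel x t)).
Proof.
  intros Hs Ht.
  set (c := - x). set (h := appell_kernel 0 t).
  (* The majorant [exp (3 |c| u)] times the Gaussian is again a kernel, with [x] replaced by
     [- 3 |c|]. *)
  set (K := mellin s (appell_kernel (- (3 * Rabs c)) t)).
  set (a := fun m => c ^ m / INR (fact m) * mellin (s + INR m) h).
  assert (Hh : exp_decay h) by now apply exp_decay_appell_kernel.
  assert (Hx : exp_decay (appell_kernel x t)) by now apply exp_decay_appell_kernel.
  assert (H3 : exp_decay (appell_kernel (- (3 * Rabs c)) t)) by now apply exp_decay_appell_kernel.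
  assert (Bd : forall n, Rabs (sum_n a n - mellin s (appell_kernel x t)) <= (/ 2) ^ S n * K).
  { intros n. rewrite sum_n_Reals. unfold a.
    destruct (mellin_exp_partial_sum s c n h Hs Hh) as [Hd E]. rewrite <- E.
    set (p := fun u => sum_f_R0 (fun m => (u * c) ^ m / INR (fact m)) n * h u) in *.
    assert (P : forall u, 0 < u ->
      Rabs (p u - appell_kernel x t u) <= (/ 2) ^ S n * appell_kernel (- (3 * Rabs c)) t u).
    { intros u Hu.
      assert (E1 : forall y, appell_kernel y t u = exp (u * - y) * h u).
      { intros y. unfold h, appell_kernel. rewrite <- exp_plus. f_equal. ring. }
      rewrite !E1. unfold p. fold c. rewrite <- Rmult_minus_distr_r, Rabs_mult.
      rewrite (Rabs_pos_eq (h u)) by (left; apply exp_pos).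
      rewrite <- Rmult_assoc. apply Rmult_le_compat_r; [left; apply exp_pos|].
      rewrite Rabs_minus_sym.
      replace (u * - - (3 * Rabs c)) with (3 * Rabs c * u) by ring.
      now apply exp_taylor_remainder. }
    pose proof (exp_decay_scal _ (-1) Hx) as Hxn.
    pose proof (exp_decay_scal _ ((/ 2) ^ S n) H3) as H3n.
    assert (Em : mellin s p - mellin s (appell_kernel x t)
      = mellin s (fun u => p u + -1 * appell_kernel x t u))
      by (rewrite mellin_plus, mellin_scal by trivial; ring).
    rewrite Em. apply Rabs_le. unfold K. split.
    - rewrite Ropp_mult_distr_l. rewrite <- mellin_scal by trivial.
      apply mellin_le; trivial.
      + now apply exp_decay_scal.
      + now apply exp_decay_plus.
      + intros u Hu. specialize (P u Hu). apply Rabs_le_between in P. lra.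
    - rewrite <- mellin_scal by trivial.
      apply mellin_le; trivial.
      + now apply exp_decay_plus.
      + intros u Hu. specialize (P u Hu). apply Rabs_le_between in P. lra. }
  change (is_lim_seq (sum_n a) (mellin s (appell_kernel x t))).
  apply is_lim_seq_ext with (u := fun n => (sum_n a n - mellin s (appell_kernel x t))
    + mellin s (appell_kernel x t)); [intros; ring|].
  replace (Finite (mellin s (appell_kernel x t)))
    with (Finite (0 + mellin s (appell_kernel x t))) by (f_equal; ring).
  apply is_lim_seq_plus'; [|apply is_lim_seq_const].
  apply is_lim_seq_abs_0.
  apply is_lim_seq_le_le with (u := fun _ => 0) (w := fun n => (/ 2) ^ S n * K).
  - intros n. split; [apply Rabs_pos|apply Bd].
  - apply is_lim_seq_const.
  - replace (Finite 0) with (Finite (0 * K)) by (f_equal; ring).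
    apply is_lim_seq_mult'; [|apply is_lim_seq_const].
    apply (is_lim_seq_incr_1 (fun n => (/ 2) ^ n)). apply is_lim_seq_geom.
    rewrite Rabs_pos_eq; lra.
Qed.

Lemma mellin_appell_kernel s x t : 0 < s -> 0 < t ->
  mellin s (appell_kernel x t)
  = mellin s (appell_kernel 0 t) * kummerM (s / 2) (1 / 2) (x ^ 2 / (2 * t))
    - x * (mellin (s + 1) (appell_kernel 0 t)
           * kummerM ((s + 1) / 2) (3 / 2) (x ^ 2 / (2 * t))).
Proof.
  intros Hs Ht.
  (* The sign is kept apart from [x^m], so that these are the coefficients of a power series in [x]
     that splits into even and odd parts. *)
  set (a := fun m => (-1) ^ m / INR (fact m) * mellin (s + INR m) (appell_kernel 0 t)).
  set (J0 := mellin s (appell_kernel 0 t)). set (J1 := mellin (s + 1) (appell_kernel 0 t)).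
  set (w := x ^ 2 / (2 * t)).
  assert (He : is_pseries (fun n => a (2 * n)%nat) (x ^ 2) (J0 * kummerM (s / 2) (1 / 2) w)).
  { eapply is_series_ext; [|apply (is_series_scal_l J0 _ _ (is_series_kummer (s / 2) (1 / 2) w ltac:(lra)))].
    intros k. rewrite pow_n_pow.
    change (J0 * kummer_term (s / 2) (1 / 2) w k = (x ^ 2) ^ k * a (2 * k)%nat).
    unfold a, kummer_term. rewrite mellin_gauss_steps, fact_even, pow_1_even by trivial.
    fold J0. unfold w.
    replace (2 / t) with (4 * / (2 * t)) by (field; lra).
    unfold Rdiv. rewrite !Rpow_mult_distr.
    pose proof (INR_fact_gt_0 k). pose proof (poch_gt_0 (1 / 2) k ltac:(lra)).
    pose proof (pow_lt 4 k ltac:(lra)). unfold Rdiv in *. field. lra. }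
  assert (Ho : is_pseries (fun n => a (2 * n + 1)%nat) (x ^ 2)
      (- J1 * kummerM ((s + 1) / 2) (3 / 2) w)).
  { eapply is_series_ext; [|apply (is_series_scal_l (- J1) _ _ (is_series_kummer ((s + 1) / 2) (3 / 2) w ltac:(lra)))].
    intros k. rewrite pow_n_pow.
    change (- J1 * kummer_term ((s + 1) / 2) (3 / 2) w k = (x ^ 2) ^ k * a (2 * k + 1)%nat).
    unfold a, kummer_term.
    replace (s + INR (2 * k + 1)) with (s + 1 + INR (2 * k)) by (rewrite plus_INR; simpl INR; ring).
    rewrite mellin_gauss_steps by lra. rewrite fact_odd.
    replace ((-1) ^ (2 * k + 1)) with (-1)
      by (rewrite Nat.add_1_r; symmetry; apply pow_1_odd).
    fold J1. unfold w.
    replace (2 / t) with (4 * / (2 * t)) by (field; lra).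
    unfold Rdiv. rewrite !Rpow_mult_distr.
    pose proof (INR_fact_gt_0 k). pose proof (poch_gt_0 (3 / 2) k ltac:(lra)).
    pose proof (pow_lt 4 k ltac:(lra)). unfold Rdiv in *. field. lra. }
  pose proof (is_pseries_odd_even a x _ _ He Ho) as H.
  pose proof (is_series_mellin_appell_kernel s x t Hs Ht) as H'.
  assert (H2 : is_series (fun m => (- x) ^ m / INR (fact m)
      * mellin (s + INR m) (appell_kernel 0 t))
      (J0 * kummerM (s / 2) (1 / 2) w + x * (- J1 * kummerM ((s + 1) / 2) (3 / 2) w))).
  { eapply is_series_ext; [|exact H]. intros m. rewrite pow_n_pow.
    change (x ^ m * a m = (- x) ^ m / INR (fact m) * mellin (s + INR m) (appell_kernel 0 t)).
    unfold a. replace (- x) with (x * -1) by ring. rewrite Rpow_mult_distr. unfold Rdiv. ring. }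
  rewrite <- (is_series_unique _ _ H'), (is_series_unique _ _ H2). ring.
Qed.

(** * The functions [calH] *)

Lemma poch_div_Gamma_shift x k j : 0 < x + INR k ->
  poch x (k + j) / Gamma (x + INR (k + j)) = poch x k / Gamma (x + INR k).
Proof.
  intros H. induction j as [|j IH]; [now rewrite Nat.add_0_r|].
  rewrite Nat.add_succ_r, <- IH, S_INR, <- Rplus_assoc.
  assert (0 < x + INR (k + j)) by (rewrite plus_INR; pose proof (pos_INR j); lra).
  rewrite Gamma_plus_1 by trivial. simpl poch.
  pose proof (Gamma_gt_0 (x + INR (k + j)) ltac:(trivial)). field. lra.
Qed.

(** Raising the shift by one multiplies numerator and denominator by the same factor. Any two
    admissible shifts thus agree with their sum, hence with each other. *)
Lemma rgamma_eq x k : 0 < x + INR k -> rgamma x = poch x k / Gamma (x + INR k).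
Proof.
  intros H. unfold rgamma. set (k0 := Z.to_nat (up (- x))).
  assert (H0 : 0 < x + INR k0).
  { unfold k0. rewrite INR_IZR_INZ. destruct (archimed (- x)) as [Hu _].
    assert (IZR (up (- x)) <= IZR (Z.of_nat (Z.to_nat (up (- x))))) by (apply IZR_le; lia).
    lra. }
  rewrite <- (poch_div_Gamma_shift x k0 k H0), <- (poch_div_Gamma_shift x k k0 H).
  now rewrite Nat.add_comm.
Qed.

Lemma rgamma_pos x : 0 < x -> rgamma x = / Gamma x.
Proof.
  intros H. rewrite (rgamma_eq x 0) by (simpl; lra). simpl. rewrite Rplus_0_r.
  unfold Rdiv. ring.
Qed.

(** Use shift [k + 1] at [x] and [k] at [x + 1]: both sides have the same denominator. This covers
    the poles of Gamma, where [rgamma] is 0. *)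
Lemma rgamma_step x : rgamma x = x * rgamma (x + 1).
Proof.
  destruct (nfloor_ex (Rabs x) (Rabs_pos x)) as [k [_ Hk]].
  pose proof (Rle_abs (- x)) as H. rewrite Rabs_Ropp in H.
  rewrite (rgamma_eq x (S k)), (rgamma_eq (x + 1) k) by (rewrite ?S_INR; lra).
  rewrite poch_shift, S_INR. replace (x + (INR k + 1)) with (x + 1 + INR k) by ring.
  unfold Rdiv. ring.
Qed.

(** The prefactor [exp (x^2 / (4 t))] cancels the Gaussian in [U], and powers of 2 and [t] merge
    into powers of [2 t]; [Rpower (2 * t) (1 / 2) / t] is the square root of [2 / t]. *)
Lemma calH_eq alpha x t : 0 < t ->
  calH alpha x t = sqrt PI * Rpower (2 * t) (alpha / 2) *
    (rgamma ((1 - alpha) / 2) * kummerM (- alpha / 2) (1 / 2) (x ^ 2 / (2 * t))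
     - x * (Rpower (2 * t) (1 / 2) / t) * rgamma (- alpha / 2)
       * kummerM ((1 - alpha) / 2) (3 / 2) (x ^ 2 / (2 * t))).
Proof.
  intros Ht. unfold calH, pcU, pcU0, pcU0', pc_u1, pc_u2.
  pose proof (sqrt_lt_R0 t Ht) as Hst. pose proof (sqrt_sqrt t ltac:(lra)) as Est.
  replace (3 / 4 + (- alpha - 1 / 2) / 2) with ((1 - alpha) / 2) by field.
  replace ((- alpha - 1 / 2) / 2 + 1 / 4) with (- (alpha / 2)) by field.
  replace (1 / 4 + (- alpha - 1 / 2) / 2) with (- alpha / 2) by field.
  replace ((- alpha - 1 / 2) / 2 - 1 / 4) with (- (alpha / 2) + - (1 / 2)) by field.
  replace ((- alpha - 1 / 2) / 2 + 3 / 4) with ((1 - alpha) / 2) by field.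
  replace (- (alpha / 2)) with (- alpha / 2) at 2 by field.
  assert (Ez : (x / sqrt t) ^ 2 = x ^ 2 / t) by (rewrite <- Est at 2; field; lra).
  rewrite Ez.
  replace (x ^ 2 / t / 2) with (x ^ 2 / (2 * t)) by (field; lra).
  set (M1 := kummerM _ (1 / 2) _). set (M2 := kummerM _ (3 / 2) _).
  replace (- (x ^ 2 / t) / 4) with (- (x ^ 2 / (4 * t))) by (field; lra).
  rewrite Rpower_plus, !Rpower_Ropp, exp_Ropp.
  rewrite <- !Rpower_mult_distr by lra.
  replace (Rpower t (1 / 2)) with (sqrt t)
    by (rewrite <- Rpower_sqrt by trivial; f_equal; field).
  set (e := exp (x ^ 2 / (4 * t))). assert (He : 0 < e) by apply exp_pos.
  pose proof (Rpower_gt_0 2 (alpha / 2)). pose proof (Rpower_gt_0 2 (1 / 2)).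
  pose proof (Rpower_gt_0 t (alpha / 2)).
  set (T := Rpower t (alpha / 2)) in *.
  clearbody e T M1 M2. set (q := sqrt t) in *. clearbody q. rewrite <- Est.
  field. lra.
Qed.

Lemma Rpower_half_sqr y : 0 < y -> Rpower y (1 / 2) * Rpower y (1 / 2) = y.
Proof.
  intros Hy. rewrite <- Rpower_plus. replace (1 / 2 + 1 / 2) with 1 by field. now apply Rpower_1.
Qed.

Lemma calH_rec alpha x t : 0 < t ->
  calH (alpha + 1) x t = x * calH alpha x t - alpha * t * calH (alpha - 1) x t.
Proof.
  intros Ht. rewrite !calH_eq by trivial.
  replace ((alpha + 1) / 2) with (alpha / 2 + 1 / 2) by field.
  replace ((alpha - 1) / 2) with (alpha / 2 + - (1 / 2)) by field.
  rewrite !Rpower_plus, Rpower_Ropp.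
  replace (- (alpha + 1) / 2) with ((1 - alpha) / 2 - 1) by field.
  replace ((1 - (alpha + 1)) / 2) with (- alpha / 2) by field.
  replace (- (alpha - 1) / 2) with ((1 - alpha) / 2) by field.
  replace ((1 - (alpha - 1)) / 2) with (- alpha / 2 + 1) by field.
  (* This leaves two reciprocal Gamma values, and the contiguous relations leave four Kummer values;
     the rest is an identity of their polynomial coefficients. *)
  rewrite (rgamma_step (- alpha / 2)), (rgamma_step ((1 - alpha) / 2 - 1)).
  replace ((1 - alpha) / 2 - 1 + 1) with ((1 - alpha) / 2) by ring.
  rewrite (kummerM_contiguous_a ((1 - alpha) / 2)), (kummerM_contiguous_b (- alpha / 2)).
  pose proof (Rpower_half_sqr (2 * t) ltac:(lra)) as Ep.
  pose proof (Rpower_gt_0 (2 * t) (1 / 2)) as Hp.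
  set (p := Rpower (2 * t) (1 / 2)) in *.
  set (P := Rpower (2 * t) (alpha / 2)).
  set (m1 := kummerM ((1 - alpha) / 2) (1 / 2) _). set (m2 := kummerM ((1 - alpha) / 2) (3 / 2) _).
  set (n1 := kummerM (- alpha / 2) (3 / 2) _). set (n2 := kummerM (- alpha / 2 + 1) (3 / 2) _).
  set (A := rgamma (- alpha / 2 + 1)). set (B := rgamma ((1 - alpha) / 2)).
  clearbody m1 m2 n1 n2 A B P p.
  assert (Et : t = p * p / 2) by lra. rewrite Et. field. lra.
Qed.

(** Both sides combine the same two Kummer functions. Equality of the even coefficients and of the
    odd ones are two forms of the duplication formula, solved for [Gamma (s/2)] or for
    [Gamma ((s+1)/2)]. *)
Lemma calH_neg s x t : 0 < s -> 0 < t ->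
  calH (- s) x t = mellin s (appell_kernel x t) / Gamma s.
Proof.
  intros Hs Ht. rewrite calH_eq, mellin_appell_kernel, !mellin_gauss by lra.
  replace ((1 - - s) / 2) with ((s + 1) / 2) by field.
  replace (- - s / 2) with (s / 2) by field.
  rewrite !rgamma_pos by lra.
  replace (- s / 2) with (- (s / 2)) by field. rewrite Rpower_Ropp.
  replace (Rpower (2 / t) ((s + 1) / 2)) with (Rpower (2 / t) (s / 2) * Rpower (2 / t) (1 / 2))
    by (rewrite <- Rpower_plus; f_equal; field).
  assert (Eq1 : Rpower (2 / t) (s / 2) = Rpower 2 s / Rpower (2 * t) (s / 2)).
  { pose proof (Rpower_gt_0 (2 * t) (s / 2)).
    apply Rmult_eq_reg_r with (Rpower (2 * t) (s / 2)); [|lra].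
    rewrite Rpower_mult_distr; [|apply Rdiv_lt_0_compat; lra|lra].
    replace (2 / t * (2 * t)) with (2 * 2) by (field; lra).
    rewrite <- Rpower_mult_distr, <- Rpower_plus by lra.
    replace (s / 2 + s / 2) with s by field. field. lra. }
  assert (Eq2 : Rpower (2 / t) (1 / 2) = Rpower (2 * t) (1 / 2) / t).
  { pose proof (Rpower_half_sqr t Ht) as E. pose proof (Rpower_gt_0 t (1 / 2)).
    assert (E2 : Rpower (2 / t) (1 / 2) * Rpower t (1 / 2) = Rpower 2 (1 / 2)).
    { rewrite Rpower_mult_distr; [|apply Rdiv_lt_0_compat; lra|lra]. f_equal. field. lra. }
    rewrite <- Rpower_mult_distr, <- E2 by lra.
    apply Rmult_eq_reg_r with t; [|lra]. field_simplify; [|lra].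
    rewrite <- E at 2. ring. }
  rewrite Eq1, Eq2.
  pose proof (Gamma_duplication s Hs) as D.
  pose proof (Gamma_gt_0 (s / 2) ltac:(lra)). pose proof (Gamma_gt_0 ((s + 1) / 2) ltac:(lra)).
  pose proof (Gamma_gt_0 s Hs). pose proof (sqrt_lt_R0 PI PI_RGT_0).
  pose proof (Rpower_gt_0 (2 * t) (s / 2)). pose proof (Rpower_gt_0 2 s).
  assert (EG : Gamma s = Rpower 2 s * Gamma (s / 2) * Gamma ((s + 1) / 2) / (2 * sqrt PI))
    by (rewrite D; field; lra).
  rewrite EG. field. repeat split; lra.
Qed.

Lemma calH_0 x t : 0 < t -> calH 0 x t = 1.
Proof.
  intros Ht. rewrite calH_eq by trivial.
  replace (- 0 / 2) with 0 by field. replace (0 / 2) with 0 by field.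
  replace ((1 - 0) / 2) with (1 / 2) by field.
  rewrite (rgamma_step 0), rgamma_pos, Gamma_half, kummerM_0_l, Rpower_O by lra.
  pose proof (sqrt_lt_R0 PI PI_RGT_0). field. lra.
Qed.

(** * Derivatives of the kernel, and the climb in [alpha] *)

Fixpoint appell_kernel_deriv (x t : R) (n : nat) (u : R) : R :=
  match n with
  | O => appell_kernel x t u
  | S m => - (x + t * u) * appell_kernel_deriv x t m u
    - match m with
      | O => 0
      | S k => INR m * t * appell_kernel_deriv x t k u
      end
  end.

Lemma appell_kernel_deriv_SS x t n u :
  appell_kernel_deriv x t (S (S n)) u
  = - (x + t * u) * appell_kernel_deriv x t (S n) u
    - INR (S n) * t * appell_kernel_deriv x t n u.
Proof. reflexivity. Qed.

Lemma is_derive_appell_kernel_deriv x t n u :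
  is_derive (appell_kernel_deriv x t n) u (appell_kernel_deriv x t (S n) u).
Proof.
  revert u.
  (* The recurrence reaches back two indices, so consecutive pairs are carried through the
     induction. *)
  enough (H : (forall u, is_derive (appell_kernel_deriv x t n) u (appell_kernel_deriv x t (S n) u))
    /\ forall u, is_derive (appell_kernel_deriv x t (S n)) u (appell_kernel_deriv x t (S (S n)) u))
    by apply H.
  induction n as [|n [IH1 IH2]].
  - assert (H0 : forall u, is_derive (appell_kernel x t) u (- (x + t * u) * appell_kernel x t u)).
    { intros u. unfold appell_kernel. auto_derive; trivial. unfold Rminus, Rdiv. simpl pow. field. }
    split; intros u.
    + simpl. rewrite Rminus_0_r. apply H0.
    + apply is_derive_ext with (f := fun u => - (x + t * u) * appell_kernel x t u).
      { intros v. simpl. ring. }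
      evar_last.
      * apply @is_derive_mult; [|apply H0|apply Rmult_comm].
        instantiate (1 := - t). auto_derive; trivial. ring.
      * unfold plus, mult; simpl. ring.
  - split; [exact IH2|]. intros u.
    apply is_derive_ext with (f := fun u => - (x + t * u) * appell_kernel_deriv x t (S n) u
      - INR (S n) * t * appell_kernel_deriv x t n u).
    { intros v. now rewrite appell_kernel_deriv_SS. }
    evar_last.
    + apply @is_derive_minus.
      * apply @is_derive_mult; [|apply IH2|apply Rmult_comm].
        instantiate (1 := - t). auto_derive; trivial. ring.
      * apply is_derive_scal. apply IH1.
    + rewrite (appell_kernel_deriv_SS x t (S n)), (S_INR (S n)).
      unfold minus, plus, opp, mult; simpl. ring.
Qed.

Lemma Derive_n_appell_kernel x t n u :
  Derive_n (appell_kernel x t) n u = appell_kernel_deriv x t n u.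
Proof.
  revert u. induction n as [|n IH]; intros u; [reflexivity|].
  simpl Derive_n. rewrite (Derive_ext _ _ _ IH). apply is_derive_unique.
  apply is_derive_appell_kernel_deriv.
Qed.

Lemma exp_decay_affine_mul a b (h : R -> R) :
  exp_decay h -> exp_decay (fun u => (a + b * u) * h u).
Proof.
  intros Hh.
  apply (exp_decay_ext (fun u => a * h u + b * (u * h u))); [intros; ring|].
  apply exp_decay_plus; apply exp_decay_scal; trivial. now apply exp_decay_mul_id.
Qed.

Lemma mellin_affine_mul s a b (h : R -> R) : 0 < s -> exp_decay h ->
  mellin s (fun u => (a + b * u) * h u) = a * mellin s h + b * mellin (s + 1) h.
Proof.
  intros Hs Hh. pose proof (exp_decay_mul_id h Hh) as Hm.
  rewrite <- mellin_mul_id, <- !mellin_scal, <- mellin_plus by (trivial; now apply exp_decay_scal).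
  apply mellin_ext; trivial.
  - now apply exp_decay_affine_mul.
  - intros; ring.
Qed.

Lemma exp_decay_appell_kernel_deriv x t n : 0 < t -> exp_decay (appell_kernel_deriv x t n).
Proof.
  intros Ht. pose proof (exp_decay_appell_kernel x t Ht) as H0.
  enough (H : exp_decay (appell_kernel_deriv x t n) /\ exp_decay (appell_kernel_deriv x t (S n)))
    by apply H.
  induction n as [|n [IH1 IH2]]; split; trivial.
  - apply (exp_decay_ext (fun u => (- x + - t * u) * appell_kernel x t u)); [intros; simpl; ring|].
    now apply exp_decay_affine_mul.
  - apply (exp_decay_ext (fun u => (- x + - t * u) * appell_kernel_deriv x t (S n) u
      + - (INR (S n) * t) * appell_kernel_deriv x t n u)).
    { intros u. rewrite appell_kernel_deriv_SS. ring. }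
    apply exp_decay_plus; [now apply exp_decay_affine_mul|now apply exp_decay_scal].
Qed.

(** For fixed [b] both sides obey the same recurrence in [n]; the case [n = 0] is the integral
    formula for negative exponents. *)
Lemma calH_mellin_deriv b x t n : 0 < b -> 0 < t ->
  calH (INR n - b) x t = (-1) ^ n / Gamma b * mellin b (appell_kernel_deriv x t n).
Proof.
  intros Hb Ht.
  pose proof (fun n => exp_decay_appell_kernel_deriv x t n Ht) as Hd.
  pose proof (Gamma_gt_0 b Hb) as HG.
  enough (H : calH (INR n - b) x t = (-1) ^ n / Gamma b * mellin b (appell_kernel_deriv x t n)
    /\ calH (INR (S n) - b) x t
       = (-1) ^ (S n) / Gamma b * mellin b (appell_kernel_deriv x t (S n))) by apply H.
  assert (H0 : calH (- b) x t = mellin b (appell_kernel x t) / Gamma b) by now apply calH_neg.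
  induction n as [|n [IH1 IH2]]; split; trivial.
  - simpl. replace (0 - b) with (- b) by ring. rewrite H0. unfold Rdiv.
    change (mellin b (fun u => appell_kernel x t u)) with (mellin b (appell_kernel x t)). ring.
  (* The recurrence at [alpha = - b] calls on [calH (- (b + 1))], again an integral; its
     [Gamma (b + 1) = b Gamma b] cancels the coefficient [b]. *)
  - replace (INR 1 - b) with (- b + 1) by (simpl; ring).
    rewrite calH_rec by trivial. replace (- b - 1) with (- (b + 1)) by ring.
    rewrite H0, calH_neg, Gamma_plus_1 by lra.
    assert (E : mellin b (appell_kernel_deriv x t 1)
      = mellin b (fun u => (- x + - t * u) * appell_kernel x t u)).
    { apply mellin_ext; trivial. intros; simpl; ring. }
    rewrite E, mellin_affine_mul by (trivial; apply (Hd 0%nat)). simpl. field. lra.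
  - replace (INR (S (S n)) - b) with ((INR (S n) - b) + 1) by (rewrite !S_INR; ring).
    rewrite calH_rec by trivial.
    replace (INR (S n) - b - 1) with (INR n - b) by (rewrite S_INR; ring).
    rewrite IH1, IH2.
    assert (E : mellin b (appell_kernel_deriv x t (S (S n)))
      = mellin b (fun u => (- x + - t * u) * appell_kernel_deriv x t (S n) u
        + - (INR (S n) * t) * appell_kernel_deriv x t n u)).
    { apply mellin_ext; trivial. intros u _. rewrite appell_kernel_deriv_SS. ring. }
    rewrite E, mellin_plus, mellin_scal, mellin_affine_mul
      by (trivial; first [now apply exp_decay_affine_mul | now apply exp_decay_scal]).
    (* The term [- t u] raises the Mellin exponent to [b + 1]; integrating by parts lowers it again
       and contributes [b t], which with [- (n + 1) t] makes [- alpha t] for [alpha = n + 1 - b]. *)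
    rewrite (mellin_by_parts b (appell_kernel_deriv x t n)) by (trivial; apply is_derive_appell_kernel_deriv).
    rewrite <- !tech_pow_Rmult. field. lra.
Qed.

Lemma calH_nat x t n : 0 < t ->
  calH (INR n) x t = (-1) ^ n * appell_kernel_deriv x t n 0.
Proof.
  intros Ht.
  enough (H : calH (INR n) x t = (-1) ^ n * appell_kernel_deriv x t n 0
    /\ calH (INR (S n)) x t = (-1) ^ S n * appell_kernel_deriv x t (S n) 0) by apply H.
  assert (E0 : appell_kernel x t 0 = 1).
  { unfold appell_kernel. rewrite <- exp_0. f_equal. field. }
  induction n as [|n [IH1 IH2]]; split; trivial.
  - simpl. rewrite calH_0, E0 by trivial. ring.
  (* At [alpha = 0] the value [calH (-1)] enters with coefficient 0. *)
  - replace (INR 1) with (0 + 1) by (simpl; ring).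
    rewrite calH_rec, calH_0 by trivial. simpl. rewrite E0. ring.
  - rewrite (S_INR (S n)), calH_rec by trivial.
    replace (INR (S n) - 1) with (INR n) by (rewrite S_INR; ring).
    rewrite IH1, IH2, appell_kernel_deriv_SS, <- !tech_pow_Rmult. ring.
Qed.

Theorem theorem3 (alpha t x : R) (ht : 0 < t) :
  calH alpha x t = appellW_pow alpha t x.
Proof.
  change (appellW_pow alpha t x) with (Linv_pow_pair alpha (appell_kernel x t)).
  unfold Linv_pow_pair.
  destruct (Rlt_dec alpha 0) as [Hneg|Hpos].
  - replace alpha with (- - alpha) at 1 by ring. rewrite calH_neg by lra.
    symmetry. apply (is_RInt_gen_unique _ (mellin (- alpha) (appell_kernel x t) / Gamma (- alpha))).
    unfold Rdiv. rewrite (Rmult_comm (mellin _ _)).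
    eapply is_int_0oo_ext; [|apply is_int_0oo_scal, mellin_correct;
      [lra|apply exp_decay_appell_kernel; trivial]].
    intros u _. cbv beta. ring.
  - destruct (Req_EM_T alpha (IZR (Int_part alpha))) as [Hint|Hnint].
    + set (n := Z.to_nat (Int_part alpha)).
      assert (En : alpha = INR n).
      { unfold n. rewrite INR_IZR_INZ, Z2Nat.id; trivial. apply le_IZR. lra. }
      rewrite En, calH_nat by trivial. now rewrite Derive_n_appell_kernel.
    + set (n := Z.to_nat (up alpha)).
      (* Since [up alpha] exceeds [alpha], [b = n - alpha] is positive and [calH_mellin_deriv]
         applies with this [b]. *)
      assert (Hn : 0 < INR n - alpha).
      { unfold n. rewrite INR_IZR_INZ. destruct (archimed alpha) as [Hu _].
        assert (IZR (up alpha) <= IZR (Z.of_nat (Z.to_nat (up alpha)))) by (apply IZR_le; lia).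
        lra. }
      replace alpha with (INR n - (INR n - alpha)) at 1 by ring.
      rewrite calH_mellin_deriv by trivial. f_equal. symmetry.
      apply (is_RInt_gen_unique _ (mellin (INR n - alpha) (appell_kernel_deriv x t n))).
      eapply is_int_0oo_ext; [|apply mellin_correct;
        [trivial|apply exp_decay_appell_kernel_deriv; trivial]].
      intros u _. simpl. now rewrite Derive_n_appell_kernel.
Qed.
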